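(* Let $n\geq 2$ and $m\geq 3$ be integers, with $n\geq 4$ if $m=3$ and $n\geq 3$ if $m=4$. Then the Fermat polynomial $$f_{n,m}(x_1,\ldots,x_n):=x_1^m+\cdots+x_n^m$$ is not $(n(m-2)-1)$-determined. In particular, $$D(n,m)=n(m-2)+1.$$
   Context: $\mathcal{O}_n=\mathbb{C}\{x_1,\ldots,x_n\}$ is the ring of convergent power series, with maximal ideal $\mathfrak{m}$. A homogeneous polynomial $f\in\mathbb{C}[x_1,\ldots,x_n]$ of degree $m$ is called regular if the hypersurface $\{f=0\}\subset\mathbb{P}^{n-1}$ is smooth (equivalently, the only common zero in $\mathbb{C}^n$ of its partial derivatives is the origin). For $f,g\in\mathcal{O}_n$ write $f\sim g$ (right equivalence) if there is a $\mathbb{C}$-algebra automorphism $\phi$ of $\mathcal{O}_n$ with $\phi(f)=g$. For an integer $k\geq 0$, $f\in\mathcal{O}_n$ is $k$-determined if every $g\in\mathcal{O}_n$ with $g\equiv f \pmod{\mathfrak{m}^{k+1}}$ satisfies $f\sim g$. $D(n,m)$ denotes the smallest integer $D>m$ with the following property: for every regular homogeneous polynomial $f\in\mathbb{C}[x_1,\ldots,x_n]$ of degree $m$, every $d\geq D$, and every $g\in\mathcal{O}_n$ with $g-f\in\mathfrak{m}^d$, the germ at the origin of $\{g=0\}$ is analytically equivalent to the germ at the origin of $\{f=0\}$, i.e. there is a $\mathbb{C}$-algebra automorphism $\phi$ of $\mathcal{O}_n$ and a unit $u\in\mathcal{O}_n$ with $\phi(f)=u\,g$. *)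

(* Defs.v *)
From HB Require Import structures.
From mathcomp Require Import all_boot all_order all_algebra.
From mathcomp Require Import boolp.
From mathcomp Require Import mpoly.

Set Implicit Arguments.
Unset Strict Implicit.
Unset Printing Implicit Defensive.

Import Order.TTheory GRing.Theory Num.Theory.
Local Open Scope ring_scope.

(* Formal power series in n variables: the coefficient of the monomial x^a is
   f a, for a multi-index a : 'X_{1..n}. A record, rather than an alias of the
   function type, so that the Cauchy product cannot be confused with the
   pointwise product of functions. *)
Record fps (n : nat) (K : Type) := Fps { fps_coef :> 'X_{1..n} -> K }.

HB.instance Definition _ n K := gen_eqMixin (fps n K).
HB.instance Definition _ n K := gen_choiceMixin (fps n K).

Section FpsRing.
Variables (n : nat) (K : comNzRingType).
Implicit Types f g h : fps n K.

Lemma fpsP f g : (forall a, f a = g a) -> f = g.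
Proof. by case: f g => [f] [g] /= /funext ->. Qed.

Definition fps_zero : fps n K := Fps (fun=> 0).
Definition fps_one : fps n K := Fps (fun a => (a == 0%MM)%:R).
Definition fps_opp f : fps n K := Fps (fun a => - f a).
Definition fps_add f g : fps n K := Fps (fun a => f a + g a).
Definition fps_scale (c : K) f : fps n K := Fps (fun a => c * f a).
Definition fps_mul f g : fps n K :=
  Fps (fun a => \sum_(k : 'X_{1..n < (mdeg a).+1, (mdeg a).+1}
                        | a == (k.1 + k.2)%MM) f k.1 * g k.2).

(* Products are computed on polynomial truncations, which reduces the ring
   axioms to those of {mpoly K[n]}. *)
Lemma fps_mulE (d : nat) (p q : {mpoly K[n]}) f g :
    (forall a, (mdeg a < d)%N -> p@_a = f a) ->
    (forall a, (mdeg a < d)%N -> q@_a = g a) ->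
  forall a, (mdeg a < d)%N -> (p * q)@_a = fps_mul f g a.
Proof.
move=> pf qg a lt_ad; rewrite mcoeffM /=; apply: eq_bigr => -[k1 k2] /= _.
by rewrite pf ?qg //; apply: leq_trans lt_ad; apply: bmdeg.
Qed.

Definition fps_trunc d f : {mpoly K[n]} :=
  \sum_(a : 'X_{1..n < d}) f a *: 'X_[a].

Lemma fps_truncE d f a : (mdeg a < d)%N -> (fps_trunc d f)@_a = f a.
Proof. by move=> lt_ad; apply: mcoeff_mpoly. Qed.

Lemma fps_mulTE d f g a : (mdeg a < d)%N ->
  fps_mul f g a = (fps_trunc d f * fps_trunc d g)@_a.
Proof.
by move=> lt_ad; rewrite -(@fps_mulE d (fps_trunc d f) (fps_trunc d g) f g)
  // => b; apply: fps_truncE.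
Qed.

Lemma fps_mul_widen d f g a : (mdeg a < d)%N ->
  fps_mul f g a =
    \sum_(k : 'X_{1..n < d, d} | a == (k.1 + k.2)%MM) f k.1 * g k.2.
Proof.
move=> lt_ad; rewrite (fps_mulTE f g lt_ad).
transitivity (\sum_(k : 'X_{1..n < d, d} | a == (k.1 + k.2)%MM)
    (fps_trunc d f)@_k.1 * (fps_trunc d g)@_k.2).
  exact: mcoeff_poly_mul.
by apply: eq_bigr => k _; rewrite !fps_truncE ?bmdeg.
Qed.

Lemma fps_addA : associative fps_add.
Proof. by move=> f g h; apply: fpsP => a /=; rewrite addrA. Qed.

Lemma fps_addC : commutative fps_add.
Proof. by move=> f g; apply: fpsP => a /=; rewrite addrC. Qed.

Lemma fps_add0 : left_id fps_zero fps_add.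
Proof. by move=> f; apply: fpsP => a /=; rewrite add0r. Qed.

Lemma fps_addN : left_inverse fps_zero fps_opp fps_add.
Proof. by move=> f; apply: fpsP => a /=; rewrite addNr. Qed.

HB.instance Definition _ := GRing.isZmodule.Build (fps n K)
  fps_addA fps_addC fps_add0 fps_addN.

Lemma fps_mulA : associative fps_mul.
Proof.
move=> f g h; apply: fpsP => a; pose T := fps_trunc (mdeg a).+1.
have TE e b : (mdeg b < (mdeg a).+1)%N -> (T e)@_b = e b by apply: fps_truncE.
have TM e e' b : (mdeg b < (mdeg a).+1)%N -> (T e * T e')@_b = fps_mul e e' b.
  by move=> lt_b; rewrite (fps_mulTE e e' lt_b).
rewrite -(fps_mulE (TE f) (TM g h) (ltnSn _)).
by rewrite -(fps_mulE (TM f g) (TE h) (ltnSn _)) mulrA.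
Qed.

Lemma fps_mulC : commutative fps_mul.
Proof.
by move=> f g; apply: fpsP => a; rewrite !(fps_mulTE _ _ (ltnSn _)) mulrC.
Qed.

Lemma fps_mul1 : left_id fps_one fps_mul.
Proof.
move=> f; apply: fpsP => a; rewrite -(@fps_mulE _ 1 (fps_trunc (mdeg a).+1 f)
  fps_one f _ _ _ (ltnSn _)) ?mul1r ?fps_truncE // => b lt_b.
  by rewrite mcoeff1.
by rewrite fps_truncE.
Qed.

Lemma fps_mulDl : left_distributive fps_mul fps_add.
Proof.
move=> f g h; apply: fpsP => a /=; rewrite -big_split /=.
by apply: eq_bigr => k _; rewrite mulrDl.
Qed.

Lemma fps_one_neq0 : fps_one != 0.
Proof.
apply/eqP => /(congr1 (fun f : fps n K => f 0%MM)) /eqP /=.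
by rewrite eqxx oner_eq0.
Qed.

HB.instance Definition _ := GRing.Zmodule_isComNzRing.Build (fps n K)
  fps_mulA fps_mulC fps_mul1 fps_mulDl fps_one_neq0.

Lemma fps_scaleA (c d : K) f : fps_scale c (fps_scale d f) = fps_scale (c * d) f.
Proof. by apply: fpsP => a /=; rewrite mulrA. Qed.

Lemma fps_scale1 : left_id 1 fps_scale.
Proof. by move=> f; apply: fpsP => a /=; rewrite mul1r. Qed.

Lemma fps_scaleDr : right_distributive fps_scale +%R.
Proof. by move=> c f g; apply: fpsP => a /=; rewrite mulrDr. Qed.

Lemma fps_scaleDl f : {morph fps_scale^~ f : c d / c + d}.
Proof. by move=> c d; apply: fpsP => a /=; rewrite mulrDl. Qed.

HB.instance Definition _ := GRing.Zmodule_isLmodule.Build K (fps n K)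
  fps_scaleA fps_scale1 fps_scaleDr fps_scaleDl.

Lemma fps_scaleAl (c : K) f g : c *: (f * g) = (c *: f) * g.
Proof.
apply: fpsP => a /=; rewrite mulr_sumr.
by apply: eq_bigr => k _; rewrite mulrA.
Qed.

HB.instance Definition _ := GRing.Lmodule_isLalgebra.Build K (fps n K)
  fps_scaleAl.
HB.instance Definition _ := GRing.Lalgebra_isComAlgebra.Build K (fps n K).

End FpsRing.

Section Convergent.
Variables (n : nat) (K : numFieldType).
Implicit Types f g : fps n K.

(* sum_a |f a| r^|a| has partial sums bounded by M. *)
Definition summable_at f (r M : K) : Prop :=
  forall d, \sum_(a : 'X_{1..n < d}) `|f a| * r ^+ mdeg a <= M.

(* Absolute convergence on some polydisc around the origin. In R[i] the
   hypothesis 0 < r forces r to be real. *)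
Definition convergent : {pred fps n K} :=
  [pred f | `[< exists r M : K, 0 < r /\ summable_at f r M >]].

Lemma summable_atW f (r s M : K) :
  0 < s -> s <= r -> summable_at f r M -> summable_at f s M.
Proof.
move=> s_gt0 le_sr fM d; apply: le_trans (fM d); apply: ler_sum => a _.
apply: ler_wpM2l => //; apply: lerXn2r => //; rewrite nnegrE ltW //.
exact: lt_le_trans le_sr.
Qed.

Lemma convergent2 f g : f \in convergent -> g \in convergent ->
  exists r M N : K, [/\ 0 < r, summable_at f r M & summable_at g r N].
Proof.
move=> /asboolP[r [M [r0 fM]]] /asboolP[s [N [s0 gN]]].
have rs0 : 0 < r + s by rewrite addr_gt0.
have t0 : 0 < r * s / (r + s) by rewrite divr_gt0 ?mulr_gt0.
exists (r * s / (r + s)), M, N; split=> //.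
  apply: (summable_atW t0 _ fM); rewrite ler_pdivrMr // ler_pM2l //.
  by rewrite lerDr ltW.
apply: (summable_atW t0 _ gN); rewrite ler_pdivrMr // mulrC ler_pM2l //.
by rewrite lerDl ltW.
Qed.

Lemma convergent_finite f (d : nat) :
  (forall a, (d <= mdeg a)%N -> f a = 0) -> f \in convergent.
Proof.
move=> f0; apply/asboolP; exists 1, (\sum_(a : 'X_{1..n < d}) `|f a|).
split=> // e; under eq_bigr do rewrite expr1n mulr1.
rewrite (bigID (fun a : 'X_{1..n < e} => mdeg a < d)%N) /=.
rewrite [X in _ + X]big1 ?addr0 => [|a]; last first.
  by rewrite -leqNgt => /f0 ->; rewrite normr0.
pose s := map (@bmnm n d) (enum {: 'X_{1..n < d}}).
pose t := map (@bmnm n e)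
  [seq a <- enum {: 'X_{1..n < e}} | (mdeg (bmnm a) < d)%N].
have -> : \sum_(a : 'X_{1..n < d}) `|f a| = \sum_(a <- s) `|f a|.
  by rewrite big_map big_enum.
have -> : \sum_(a : 'X_{1..n < e} | (mdeg a < d)%N) `|f a|
    = \sum_(a <- t) `|f a|.
  by rewrite big_map big_filter big_enum_cond.
have us : uniq s.
  by rewrite map_inj_uniq ?enum_uniq //; apply: (@val_inj _ _ 'X_{1..n < d}).
have ut : uniq t.
  rewrite map_inj_uniq ?filter_uniq -?enumT ?enum_uniq //.
  exact: (@val_inj _ _ 'X_{1..n < e}).
have tE : perm_eq t [seq a <- s | a \in t].
  apply: uniq_perm => //; first exact: filter_uniq.
  move=> a; rewrite mem_filter; case at_: (a \in t) => //=; apply/esym.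
  case/mapP: at_ => b; rewrite mem_filter => /andP[bd _] ->.
  by apply/mapP; exists (BMultinom bd); rewrite ?mem_enum.
rewrite (perm_big _ tE) /= big_filter [leRHS](bigID (mem t)) /=.
by rewrite lerDl sumr_ge0.
Qed.

Lemma convergentD f g :
  f \in convergent -> g \in convergent -> f + g \in convergent.
Proof.
move=> fc gc; have [r [M [N [r0 fM gN]]]] := convergent2 fc gc.
apply/asboolP; exists r, (M + N); split=> // d.
apply: le_trans (lerD (fM d) (gN d)); rewrite -big_split /=.
apply: ler_sum => a _; rewrite -mulrDl ler_wpM2r ?exprn_ge0 ?(ltW r0) //.
exact: ler_normD.
Qed.

Lemma convergentZ (c : K) f : f \in convergent -> c *: f \in convergent.
Proof.
move=> /asboolP[r [M [r0 fM]]]; apply/asboolP; exists r, (`|c| * M).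
split=> // d; apply: le_trans (ler_wpM2l (normr_ge0 c) (fM d)).
by rewrite mulr_sumr ler_sum // => a _; rewrite /= normrM mulrA.
Qed.

Lemma convergentM f g :
  f \in convergent -> g \in convergent -> f * g \in convergent.
Proof.
move=> fc gc; have [r [M [N [r0 fM gN]]]] := convergent2 fc gc.
apply/asboolP; exists r, (M * N); split=> // d.
have F0 (h : fps n K) (a : 'X_{1..n}) : 0 <= `|h a| * r ^+ mdeg a :> K.
  by rewrite mulr_ge0 ?exprn_ge0 ?(ltW r0).
pose F (h : fps n K) (a : 'X_{1..n}) := `|h a| * r ^+ mdeg a.
apply: (@le_trans _ _ ((\sum_(a : 'X_{1..n < d}) F f a) *
                       (\sum_(a : 'X_{1..n < d}) F g a))); last first.
  by apply: ler_pM; rewrite ?sumr_ge0 ?fM ?gN // => a _; apply: F0.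
rewrite big_distrlr pair_big /=.
pose P (a : 'X_{1..n < d}) (k : 'X_{1..n < d, d}) := bmnm a == (k.1 + k.2)%MM.
apply: (@le_trans _ _ (\sum_(a : 'X_{1..n < d})
    \sum_(k : 'X_{1..n < d, d} | P a k) F f k.1 * F g k.2)).
  apply: ler_sum => a _; have /= -> := fps_mul_widen f g (bmdeg a).
  apply: le_trans (ler_wpM2r _ (ler_norm_sum _ _ _)) _.
    by rewrite exprn_ge0 ?ltW.
  rewrite mulr_suml; apply: ler_sum => k /eqP ->.
  by rewrite /F normrM mdegD exprD mulrACA.
rewrite (exchange_big_dep xpredT) //=; apply: ler_sum => k _.
have FF0 : 0 <= F f k.1 * F g k.2 by rewrite mulr_ge0 ?F0.
have [lt_kd|ge_kd] := ltnP (mdeg (k.1 + k.2)%MM) d.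
  by rewrite (big_pred1 (BMultinom lt_kd)) // => a; rewrite /P bmeqP.
rewrite big_pred0 // => a; apply/negbTE/eqP => ak.
by move: (bmdeg a); rewrite ak ltnNge ge_kd.
Qed.

Lemma convergent_subalg : subalg_closed convergent.
Proof.
split=> [|c f g fc gc|f g]; last exact: convergentM.
  apply: (@convergent_finite _ 1) => a /=.
  by case: eqVneq => // ->; rewrite mdeg0.
by apply: convergentD => //; apply: convergentZ.
Qed.

HB.instance Definition _ :=
  GRing.isSubalgClosed.Build K (fps n K) convergent convergent_subalg.

End Convergent.

(* K{x_1, ..., x_n}; for K := R[i] this is the ring O_n. *)
Record cps (n : nat) (K : numFieldType) :=
  Cps { cps_fps :> fps n K; _ : cps_fps \in @convergent n K }.

HB.instance Definition _ n K := [isSub for @cps_fps n K].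
HB.instance Definition _ n K := [Choice of cps n K by <:].
HB.instance Definition _ n (K : numFieldType) :=
  [SubChoice_isSubAlgebra of cps n K by <:].
HB.instance Definition _ n (K : numFieldType) :=
  [SubNzRing_isSubComNzRing of cps n K by <:].

Section Units.
Variables (n : nat) (K : numFieldType).
Implicit Types u v : cps n K.

(* Invertibility in the ring cps n K itself, not in fps n K. *)
Definition cps_unit : {pred cps n K} := [pred u | `[< exists v, v * u = 1 >]].

Definition cps_inv u : cps n K :=
  match pselect (exists v, v * u = 1) with
  | left uV => projT1 (cid uV)
  | right _ => u
  end.

Lemma cps_mulVr : {in cps_unit, left_inverse 1 cps_inv *%R}.
Proof.
move=> u /asboolP uV; rewrite /cps_inv; case: pselect => // uV'.
exact: (projT2 (cid uV')).
Qed.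

Lemma cps_unitPl u v : v * u = 1 -> cps_unit u.
Proof. by move=> vu; apply/asboolP; exists v. Qed.

Lemma cps_inv_out : {in [predC cps_unit], cps_inv =1 id}.
Proof. by move=> u /asboolPn uV; rewrite /cps_inv; case: pselect. Qed.

HB.instance Definition _ := GRing.ComNzRing_hasMulInverse.Build (cps n K)
  cps_mulVr cps_unitPl cps_inv_out.

End Units.

Section Determinacy.
Variables (n : nat) (K : numFieldType).
Implicit Types (f g : cps n K) (p : {mpoly K[n]}).

Lemma mpoly_convergent p : Fps (fun a => p@_a) \in @convergent n K.
Proof.
by apply: (@convergent_finite _ _ _ (msize p)) => a /msize_mdeg_ge /memN_msupp_eq0.
Qed.

Definition cps_of_mpoly p : cps n K := Cps (mpoly_convergent p).

(* The maximal ideal of cps n K: the germs vanishing at the origin. *)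
Definition maxideal f : Prop := f 0%MM = 0.

(* k-th power of an ideal I: finite sums of products of an element of I and
   an element of the (k-1)-th power, the 0-th power being the whole ring. *)
Fixpoint ideal_pow (A : comNzRingType) (I : A -> Prop) (k : nat) : A -> Prop :=
  if k is k'.+1 then fun x =>
    exists2 s : seq (A * A),
      forall y, y \in s -> I y.1 /\ ideal_pow I k' y.2 &
      x = \sum_(y <- s) y.1 * y.2
  else fun=> True.

Definition right_equiv f g : Prop :=
  exists2 phi : {lrmorphism cps n K -> cps n K}, bijective phi & phi f = g.

Definition contact_equiv f g : Prop :=
  exists2 phi : {lrmorphism cps n K -> cps n K}, bijective phi &
    exists2 u : cps n K, u \is a GRing.unit & phi f = u * g.

Definition determined (k : nat) f : Prop :=
  forall g, ideal_pow maxideal k.+1 (g - f) -> right_equiv f g.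

(* A point of {p = 0} in projective space is represented by its homogeneous
   coordinates v != 0; smoothness there is the Jacobian criterion. *)
Definition regular (m : nat) p : Prop :=
  p \is m.-homog /\
  forall v : 'I_n -> K, (exists i, v i != 0) -> p.@[v] = 0 ->
    exists i, (p^`M(i)).@[v] != 0.

Definition D_property (m D : nat) : Prop :=
  forall p, regular m p -> forall d, (D <= d)%N -> forall g,
    ideal_pow maxideal d (g - cps_of_mpoly p) ->
    contact_equiv (cps_of_mpoly p) g.

(* D is the number D(n, m); that such a D exists is part of the assertion. *)
Definition is_Dnm (m D : nat) : Prop :=
  [/\ (m < D)%N, D_property m D &
      forall D', (m < D')%N -> D_property m D' -> (D <= D')%N].

Definition fermat (m : nat) : {mpoly K[n]} := \sum_(i < n) 'X_i ^+ m.

End Determinacy.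

(* Main.v *)
(** Write N = n(m-2), and let w be the monomial (x_1 ... x_n)^(m-2) of degree N > m.

    Lower bound.  Suppose phi(f) = u g for f the Fermat polynomial and g = f + w.  With
    y_i = phi(x_i), the chain rule and the invertibility of the Jacobian matrix of y
    turn Euler's identity for f into a relation v g = sum_j b_j (d g / d x_j) with v a
    unit and all b_j in the maximal ideal.  Comparing coefficients at x_j^m and at w
    gives v(0) = m b_j[x_j] and v(0) = (m-2) sum_j b_j[x_j], whence N = m.

    Upper bound.  Let p be regular.  By the Nullstellensatz (proved by counting
    dimensions against the uncountability of C) the ideal J of the partial derivatives
    of p contains a power of each variable, and the Bezoutian of the partial derivatives
    then shows that J contains every form of degree greater than N.  Hence there is a
    bounded right inverse T of c |-> sum_i c_i (d p / d x_i) on germs of order at least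
    N + 1, and the equation p(x + c) = p + h amounts to c = T(h - Q(c)), where Q(c) is
    the part of order at least 2 in c of p(x + c).  It is solved formally degree by
    degree, with convergence by majorants.  Inverting x |-> x + c in the same way gives
    the automorphism. *)

From HB Require Import structures.
Require Import Defs.
From mathcomp Require Import all_boot all_order all_algebra.
From mathcomp Require Import reals complex.
From mathcomp Require Import zify ring lra boolp mpoly.

Set Implicit Arguments.
Unset Strict Implicit.
Unset Printing Implicit Defensive.

Import Order.TTheory GRing.Theory Num.Theory.
Local Open Scope ring_scope.

(** * Formal power series *)

(** The obstruction is proved for contact equivalence, which right equivalence implies with u = 1;
    so it refutes determinacy and bounds D from below at the same time. The equation p(x + c) = p +
    h gives a right equivalence, which is more than the upper bound for D asks.

    Automorphisms are given as bare algebra morphisms. That they preserve the maximal ideal, hence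
    the order of germs, is derived from units and from division by monomials; only then are they
    known to be determined by their values on the coordinates.

    Put k + m = N + 1. The lift c has order k + 1, and Q(c), being quadratic in c, has order at
    least 2(k + 1) + m - 2 = N + 1 + k. So Q(c) stays in the domain of T, and for k > 0 each
    iteration gains an order. The conditions on (n, m) amount to N > m, which contradicts N = m in
    the lower bound and also gives k > 0. *)

Lemma mnm_split n (a : 'X_{1..n}) d : mdeg a = d.+1 ->
  exists2 i, (U_(i) <= a)%MM & mdeg (a - U_(i))%MM = d.
Proof.
move=> ad; have [i ai] : exists i, a i != 0%N.
  apply/existsP; apply: contra_eqT ad; rewrite negb_exists => /forallP a0.
  by rewrite mdegE big1 // => i _; move: (a0 i); rewrite negbK => /eqP.
have le_ia : (U_(i) <= a)%MM by rewrite lep1mP.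
by exists i => //; apply/eqP; rewrite -eqSS -ad -{2}(submK le_ia) mdegD mdeg1 addn1.
Qed.

Section Series.
Variables (n : nat) (K : comNzRingType).
Implicit Types (f g h : fps n K) (p q : {mpoly K[n]}) (a b c : 'X_{1..n}).

Lemma fpsDE f g a : (f + g) a = f a + g a. Proof. by []. Qed.
Lemma fpsNE f a : (- f) a = - f a. Proof. by []. Qed.
Lemma fpsBE f g a : (f - g) a = f a - g a. Proof. by []. Qed.
Lemma fpsZE (k : K) f a : (k *: f) a = k * f a. Proof. by []. Qed.
Lemma fps1E a : (1 : fps n K) a = (a == 0%MM)%:R. Proof. by []. Qed.
Lemma fps_sumE (I : Type) (r : seq I) (P : pred I) (F : I -> fps n K) a :
  (\sum_(i <- r | P i) F i) a = \sum_(i <- r | P i) F i a.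
Proof. by elim/big_rec2: _ => // i x y _ <-. Qed.

Lemma fpsME d f g a : (mdeg a < d)%N ->
  (f * g) a = (fps_trunc d f * fps_trunc d g)@_a.
Proof. exact: fps_mulTE. Qed.

Definition fps_of_mpoly p : fps n K := Fps (fun a => p@_a).

Lemma fps_of_mpoly_additive : additive fps_of_mpoly.
Proof. by move=> p q; apply: fpsP => a /=; rewrite mcoeffB. Qed.

Lemma fps_of_mpoly_multiplicative : multiplicative fps_of_mpoly.
Proof.
split=> [p q|]; last by apply: fpsP => a /=; rewrite mcoeff1.
by apply: fpsP => a; apply: (@fps_mulE _ _ (mdeg a).+1 p q).
Qed.

Lemma fps_of_mpoly_scalable : scalable fps_of_mpoly.
Proof. by move=> k p; apply: fpsP => a /=; rewrite mcoeffZ. Qed.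

HB.instance Definition _ := GRing.isAdditive.Build {mpoly K[n]} (fps n K)
  fps_of_mpoly fps_of_mpoly_additive.
HB.instance Definition _ := GRing.isMultiplicative.Build {mpoly K[n]} (fps n K)
  fps_of_mpoly fps_of_mpoly_multiplicative.
HB.instance Definition _ := GRing.isScalable.Build K {mpoly K[n]} (fps n K) *:%R
  fps_of_mpoly fps_of_mpoly_scalable.

Local Notation Xm a := (fps_of_mpoly 'X_[a]).

Lemma fpsMX f a b : (f * Xm a) b = if (a <= b)%MM then f (b - a)%MM else 0.
Proof.
set d := (mdeg b).+1.
pose p := fps_trunc d f; transitivity ((p * 'X_[a])@_b).
  by apply/esym/(@fps_mulE _ _ d p 'X_[a] f (Xm a)) => // c; apply: fps_truncE.
case: ifP => le_ab.
  transitivity p@_(b - a)%MM; last by rewrite fps_truncE // ltnS mdegB.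
  by rewrite -(mcoeffMX p a) addmC submK.
rewrite (mcoeff_poly_mul_lin_rev _ _ (k := d)) // big1 // => c le_cb.
by rewrite mcoeffX; case: eqP => [E|]; [rewrite E le_cb in le_ab|rewrite mulr0].
Qed.

Lemma fpsXM f a b : (Xm a * f) b = if (a <= b)%MM then f (b - a)%MM else 0.
Proof. by rewrite mulrC fpsMX. Qed.

Definition fps_const f : K := f 0%MM.

Lemma fps_const_additive : additive fps_const. Proof. by []. Qed.

Lemma fps_const_multiplicative : multiplicative fps_const.
Proof.
split=> [f g|]; last by rewrite /fps_const /= eqxx.
have lt0 : (mdeg (0%MM : 'X_{1..n}) < 1)%N by rewrite mdeg0.
rewrite /fps_const (fpsME _ _ lt0).
rewrite (rmorphM (mcoeff 0%MM)) /= ; congr (_ * _); exact: fps_truncE.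
Qed.

HB.instance Definition _ := GRing.isAdditive.Build (fps n K) K
  fps_const fps_const_additive.
HB.instance Definition _ := GRing.isMultiplicative.Build (fps n K) K
  fps_const fps_const_multiplicative.

Lemma fpsM0 f g : (f * g) 0%MM = f 0%MM * g 0%MM.
Proof. exact: (rmorphM fps_const). Qed.

Definition ordge (d : nat) f : Prop := forall a, (mdeg a < d)%N -> f a = 0.

Lemma ordge0 f : ordge 0 f. Proof. by []. Qed.

Lemma ordgeW d e f : (d <= e)%N -> ordge e f -> ordge d f.
Proof. by move=> de fe a ad; apply: fe; apply: leq_trans de. Qed.

Lemma ordgeD d f g : ordge d f -> ordge d g -> ordge d (f + g).
Proof. by move=> fd gd a ad; rewrite fpsDE fd ?gd ?addr0. Qed.

Lemma ordgeN d f : ordge d f -> ordge d (- f).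
Proof. by move=> fd a ad; rewrite fpsNE fd ?oppr0. Qed.

Lemma ordgeB d f g : ordge d f -> ordge d g -> ordge d (f - g).
Proof. by move=> fd gd; apply: ordgeD => //; apply: ordgeN. Qed.

Lemma ordge_sum d (I : Type) (r : seq I) (P : pred I) (F : I -> fps n K) :
  (forall i, P i -> ordge d (F i)) -> ordge d (\sum_(i <- r | P i) F i).
Proof.
by move=> Fd; elim/big_ind: _ => //; apply: ordgeD.
Qed.

Lemma ordgeZ d (k : K) f : ordge d f -> ordge d (k *: f).
Proof. by move=> fd a ad; rewrite fpsZE fd ?mulr0. Qed.

Lemma ordgeM d e f g : ordge d f -> ordge e g -> ordge (d + e) (f * g).
Proof.
move=> fd ge a ad /=; rewrite big1 // => -[b c] /= /eqP E.
have [bd|bd] := ltnP (mdeg b) d; first by rewrite fd ?mul0r.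
rewrite [X in _ * X]ge ?mulr0 //.
have {}E : mdeg a = (mdeg b + mdeg c)%N by rewrite -mdegD -E.
rewrite -(ltn_add2l d); apply: leq_ltn_trans ad.
by apply: leq_trans (eq_leq (esym E)); rewrite leq_add2r.
Qed.

Lemma ordgeMr d f g : ordge d f -> ordge d (f * g).
Proof. by move=> fd; rewrite -[d]addn0; apply: ordgeM. Qed.

Lemma ordgeMl d f g : ordge d g -> ordge d (f * g).
Proof. by move=> gd; rewrite mulrC; apply: ordgeMr. Qed.

Lemma ordge1 f : ordge 1 f <-> f 0%MM = 0.
Proof.
split=> [->|f0 a]; rewrite ?mdeg0 // ltnS leqn0 mdeg_eq0 => /eqP ->.
exact: f0.
Qed.

Lemma ordgeX a : ordge (mdeg a) (Xm a).
Proof.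
by move=> b ba; rewrite /= mcoeffX; case: eqP ba => // ->; rewrite ltnn.
Qed.

Lemma ordge_homog d p : p \is d.-homog -> ordge d (fps_of_mpoly p).
Proof.
move=> pd a ad; rewrite /=; apply: (dhomog_nemf_coeff pd).
by rewrite neq_ltn ad.
Qed.

Lemma ordge_eq f g : (forall d, ordge d (f - g)) -> f = g.
Proof.
move=> fg; apply: fpsP => a; apply/eqP; rewrite -subr_eq0 -fpsBE.
by rewrite (fg (mdeg a).+1).
Qed.

Lemma ordge_sub d f g a : ordge d (f - g) -> (mdeg a < d)%N -> f a = g a.
Proof. by move=> fg ad; apply/eqP; rewrite -subr_eq0 -fpsBE fg. Qed.

Lemma ordge_trunc d f : ordge d (f - fps_of_mpoly (fps_trunc d f)).
Proof. by move=> a ad; rewrite fpsBE /= fps_truncE ?subrr. Qed.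

Lemma exists_submnm d a : (d <= mdeg a)%N ->
  exists b : 'X_{1..n < d.+1}, (b <= a)%MM && (mdeg b == d).
Proof.
move=> le_da; suff [b /andP[ba bd]] : exists b, (b <= a)%MM && (mdeg b == d).
  have bd' : (mdeg b < d.+1)%N by rewrite (eqP bd).
  by exists (BMultinom bd'); rewrite ba.
move/subnKC: le_da; move: (_ - _)%N => k; elim: k a => [|k IH] a.
  by rewrite addn0 => ->; exists a; rewrite lepm_refl eqxx.
rewrite addnS => /esym/mnm_split[i _ /esym/IH[b /andP[ba bd]]].
by exists b; rewrite bd andbT (lepm_trans ba) // lem_subr.
Qed.

(** The divisor depends on the multi-index alone, not on any series; this makes division by X^b
    additive. The default is met only below degree d. *)
Definition submnm d a : 'X_{1..n < d.+1} :=
  odflt (@bm0 n d) [pick b : 'X_{1..n < d.+1} | (b <= a)%MM && (mdeg b == d)].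

Lemma submnmP d a : (d <= mdeg a)%N -> (submnm d a <= a)%MM /\ mdeg (submnm d a) = d.
Proof.
move=> /exists_submnm[b bP]; rewrite /submnm; case: pickP => [c /andP[? /eqP]|] //.
by move/(_ b); rewrite bP.
Qed.

(* The multi-indices of degree at least d are distributed over those of degree
   d, so that f becomes the sum of the X^b * fps_quo b f. *)
Definition fps_quo d (b : 'X_{1..n < d.+1}) f : fps n K :=
  Fps (fun c => if submnm d (b + c)%MM == b then f (b + c)%MM else 0).

Lemma fps_decomp d f : ordge d f ->
  f = \sum_(b : 'X_{1..n < d.+1} | mdeg b == d) Xm b * fps_quo b f.
Proof.
move=> fd; apply: fpsP => a; rewrite fps_sumE.
have [da|ad] := leqP d (mdeg a); last first.
  rewrite fd // big1 // => b /eqP bd; rewrite fpsXM; case: ifP => // /mnm_lepP ba.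
  suff : (d <= mdeg a)%N by rewrite leqNgt ad.
  by rewrite -bd !mdegE leq_sum.
have [le_sa sd] := submnmP da.
rewrite (bigD1 (submnm d a)) ?sd // big1 => [|b /andP[_ bs]]; last first.
  rewrite fpsXM; case: ifP => // ba.
  by rewrite /= addmC submK // eq_sym (negbTE bs).
by rewrite fpsXM le_sa /= addr0 addmC submK // eqxx.
Qed.

Lemma fps_quoB d (b : 'X_{1..n < d.+1}) f g :
  fps_quo b (f - g) = fps_quo b f - fps_quo b g.
Proof.
by apply: fpsP => a; rewrite fpsBE /=; case: ifP; rewrite ?subr0.
Qed.

Lemma ordge_quo d e (b : 'X_{1..n < d.+1}) f :
  mdeg b = d -> ordge (d + e) f -> ordge e (fps_quo b f).
Proof.
by move=> bd fe a ae /=; case: ifP => // _; apply: fe; rewrite mdegD bd ltn_add2l.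
Qed.

Definition fps_deriv (i : 'I_n) f : fps n K :=
  Fps (fun a => f (a + U_(i))%MM *+ (a i).+1).

Lemma fps_derivM i f g :
  fps_deriv i (f * g) = fps_deriv i f * g + f * fps_deriv i g.
Proof.
(* Two more than |a|, because the derivative at a reads the coefficient at a + U_(i). *)
apply: fpsP => a; rewrite fpsDE; set d := (mdeg a).+2.
have ltd : (mdeg (a + U_(i))%MM < d)%N by rewrite mdegD mdeg1 addn1.
have T h b : (mdeg b < d)%N -> (fps_trunc d h)@_b = h b by exact: fps_truncE.
have T' h b : (mdeg b < d.-1)%N -> (fps_trunc d h)^`M(i)@_b = fps_deriv i h b.
  by move=> bd; rewrite mcoeff_deriv T // mdegD mdeg1 addn1.
have T1 h b : (mdeg b < d.-1)%N -> (fps_trunc d h)@_b = h b.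
  by move=> bd; rewrite T // (leq_trans bd).
rewrite [LHS]/= [X in X *+ _](fpsME _ _ ltd) -mcoeff_deriv mderivM mcoeffD.
by congr (_ + _); apply: (@fps_mulE _ _ d.-1); auto.
Qed.

Lemma fps_derivD i f g : fps_deriv i (f + g) = fps_deriv i f + fps_deriv i g.
Proof. by apply: fpsP => a; rewrite [RHS]fpsDE /= mulrnDl. Qed.

Lemma fps_deriv0 i : fps_deriv i 0 = 0.
Proof. by apply: fpsP => a; rewrite /= mul0rn. Qed.

Lemma fps_deriv_sum i (I : Type) (r : seq I) (P : pred I) (F : I -> fps n K) :
  fps_deriv i (\sum_(j <- r | P j) F j) = \sum_(j <- r | P j) fps_deriv i (F j).
Proof.
exact: (big_morph _ (fps_derivD i) (fps_deriv0 i)).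
Qed.

Lemma fps_derivX i f k : fps_deriv i (f ^+ k.+1) = (f ^+ k * fps_deriv i f) *+ k.+1.
Proof.
elim: k => [|k IH]; first by rewrite expr1 expr0 mul1r.
by rewrite exprS fps_derivM IH mulrnAr mulrA -exprS mulrC -mulrS.
Qed.

Lemma fps_deriv_mpoly i p : fps_deriv i (fps_of_mpoly p) = fps_of_mpoly p^`M(i).
Proof. by apply: fpsP => a; rewrite /= mcoeff_deriv. Qed.

Lemma fps_deriv_const i f : fps_deriv i f 0%MM = f U_(i)%MM.
Proof. by rewrite /= mnm0E add0m mulr1n. Qed.

End Series.

(** * Majorants and convergence *)

Section Majorants.
Variables (n : nat) (K : numFieldType).
Implicit Types (f g h : fps n K) (p q : {mpoly K[n]}) (a b c : 'X_{1..n}).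
Implicit Types (r M N : K).

Local Notation Xm a := (fps_of_mpoly 'X_[a]).

Definition fps_psum d f r : K := \sum_(a : 'X_{1..n < d}) `|f a| * r ^+ mdeg a.

Lemma fps_psum_ge0 d f r : 0 <= r -> 0 <= fps_psum d f r.
Proof. by move=> r0; apply: sumr_ge0 => a _; rewrite mulr_ge0 ?exprn_ge0. Qed.

Lemma summable_ge0 f r M : summable_at f r M -> 0 <= M.
Proof.
move=> /(_ 0%N); rewrite big1 // => a _; by have := bmdeg a; rewrite ltn0.
Qed.

Lemma summable_le f g r M : 0 <= r -> (forall a, `|f a| <= `|g a|) ->
  summable_at g r M -> summable_at f r M.
Proof.
move=> r0 fg gM d; apply: le_trans (gM d); apply: ler_sum => a _.
by rewrite ler_wpM2r ?exprn_ge0.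
Qed.

Lemma summableW f r M N : M <= N -> summable_at f r M -> summable_at f r N.
Proof. by move=> MN fM d; apply: le_trans (fM d) MN. Qed.

Lemma summable0 r M : 0 <= M -> summable_at (0 : fps n K) r M.
Proof. by move=> M0 d; rewrite big1 // => a _; rewrite normr0 mul0r. Qed.

Lemma summableD f g r M N : 0 <= r ->
  summable_at f r M -> summable_at g r N -> summable_at (f + g) r (M + N).
Proof.
move=> r0 fM gN d; apply: le_trans (lerD (fM d) (gN d)); rewrite -big_split /=.
apply: ler_sum => a _; rewrite -mulrDl ler_wpM2r ?exprn_ge0 //.
exact: ler_normD.
Qed.

Lemma summableN f r M : summable_at f r M -> summable_at (- f) r M.
Proof.
by move=> fM d; under eq_bigr do rewrite fpsNE normrN; apply: fM.
Qed.

Lemma summableB f g r M N : 0 <= r ->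
  summable_at f r M -> summable_at g r N -> summable_at (f - g) r (M + N).
Proof. by move=> r0 fM gN; apply: summableD => //; apply: summableN. Qed.

Lemma summableZ (k : K) f r M : summable_at f r M -> summable_at (k *: f) r (`|k| * M).
Proof.
move=> fM d; apply: le_trans (ler_wpM2l (normr_ge0 k) (fM d)).
by rewrite mulr_sumr ler_sum // => a _; rewrite /= normrM mulrA.
Qed.

Lemma summable_sum r (I : Type) (s : seq I) (P : pred I) (F : I -> fps n K) (M : I -> K) :
  0 <= r -> (forall i, P i -> summable_at (F i) r (M i)) ->
  summable_at (\sum_(i <- s | P i) F i) r (\sum_(i <- s | P i) M i).
Proof.
move=> r0 FM; elim/big_rec2: _ => [|i f N Pi fN]; first exact: summable0.
by apply: summableD => //; apply: FM.
Qed.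

(** The weighted norm is submultiplicative: the pairs (b, c) with |b + c| < d are among those with
    both degrees below d, and the remaining pairs contribute non-negative terms. *)
Lemma summableM f g r M N : 0 <= r ->
  summable_at f r M -> summable_at g r N -> summable_at (f * g) r (M * N).
Proof.
move=> r0 fM gN d.
apply: (@le_trans _ _ (fps_psum d f r * fps_psum d g r)); last first.
  by apply: ler_pM; rewrite ?fps_psum_ge0 ?fM ?gN.
rewrite /fps_psum big_distrlr pair_big /=.
pose P (a : 'X_{1..n < d}) (k : 'X_{1..n < d, d}) := bmnm a == (k.1 + k.2)%MM.
pose F f (a : 'X_{1..n}) := `|f a| * r ^+ mdeg a.
have F0 f' a : 0 <= F f' a by rewrite mulr_ge0 ?exprn_ge0.
apply: (@le_trans _ _ (\sum_(a : 'X_{1..n < d})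
    \sum_(k : 'X_{1..n < d, d} | P a k) F f k.1 * F g k.2)).
  apply: ler_sum => a _; have /= -> := fps_mul_widen f g (bmdeg a).
  apply: le_trans (ler_wpM2r _ (ler_norm_sum _ _ _)) _.
    by rewrite exprn_ge0.
  rewrite mulr_suml; apply: ler_sum => k /eqP ->.
  by rewrite /F normrM mdegD exprD mulrACA.
rewrite (exchange_big_dep xpredT) //=; apply: ler_sum => k _.
have FF0 : 0 <= F f k.1 * F g k.2 by rewrite mulr_ge0 ?F0.
have [lt_kd|ge_kd] := ltnP (mdeg (k.1 + k.2)%MM) d.
  by rewrite (big_pred1 (BMultinom lt_kd)) // => a; rewrite /P bmeqP.
rewrite big_pred0 // => a; apply/negbTE/eqP => ak.
by move: (bmdeg a); rewrite ak ltnNge ge_kd.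
Qed.

Lemma summableXm r a : 0 <= r -> summable_at (Xm a) r (r ^+ mdeg a).
Proof.
move=> r0 d; have [ad|da] := ltnP (mdeg a) d; last first.
  rewrite big1 ?exprn_ge0 // => b _; rewrite /= mcoeffX; case: eqP => [E|].
    by have := bmdeg b; rewrite -E ltnNge da.
  by rewrite normr0 mul0r.
rewrite (bigD1 (BMultinom ad)) // big1 => [|b] /=.
  by rewrite mcoeffX eqxx normr1 mul1r addr0.
by rewrite bmeqP /= mcoeffX eq_sym => /negbTE ->; rewrite normr0 mul0r.
Qed.

Definition mnorm p : K := \sum_(a <- msupp p) `|p@_a|.

Lemma mnorm_ge0 p : 0 <= mnorm p. Proof. exact: sumr_ge0. Qed.

Lemma fps_of_mpolyX p : fps_of_mpoly p = \sum_(a <- msupp p) p@_a *: Xm a.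
Proof. by rewrite {1}[p]mpolyE linear_sum; apply: eq_bigr => a _; rewrite linearZ. Qed.

Lemma summable_homog d p r : 0 <= r -> p \is d.-homog ->
  summable_at (fps_of_mpoly p) r (mnorm p * r ^+ d).
Proof.
move=> r0 pd; rewrite fps_of_mpolyX mulr_suml !big_seq; apply: summable_sum => // a ap.
by apply: summableZ; rewrite -(dhomog_mf pd ap); apply: summableXm.
Qed.

(** Multiplication by X^b shifts the coefficients injectively, so the partial sum of f reappears,
    scaled by r^|b|, among the terms on the right. *)
Lemma fps_psum_Xm d f b r : 0 <= r ->
  fps_psum d f r * r ^+ mdeg b <= fps_psum (mdeg b + d) (Xm b * f) r.
Proof.
move=> r0; rewrite /fps_psum.
have F0 (a : 'X_{1..n < mdeg b + d}) : 0 <= `|(Xm b * f) a| * r ^+ mdeg a.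
  by rewrite mulr_ge0 ?exprn_ge0.
have hP (c : 'X_{1..n < d}) : (mdeg (b + c)%MM < mdeg b + d)%N.
  by rewrite mdegD ltn_add2l bmdeg.
have hP' (a : 'X_{1..n < mdeg b + d}) : (mdeg (a - b)%MM < mdeg b + d)%N.
  by rewrite (leq_ltn_trans (mdegB _ _)) ?bmdeg.
rewrite [leRHS](bigID (fun a : 'X_{1..n < mdeg b + d} => (b <= a)%MM)).
rewrite -[leLHS]addr0; apply: lerD; last first.
  by apply: sumr_ge0 => a _; apply: F0.
rewrite (reindex_omap (fun c : 'X_{1..n < d} => BMultinom (hP c))
   (fun a : 'X_{1..n < mdeg b + d} => insub (a - b)%MM : option 'X_{1..n < d})); last first.
  move=> a ba; have ad : (mdeg (a - b)%MM < d)%N.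
    by rewrite -(ltn_add2l (mdeg b)) -mdegD addmC submK ?bmdeg //.
  by rewrite insubT /=; congr Some; apply: val_inj; rewrite /= addmC submK.
rewrite mulr_suml [leRHS](eq_bigl xpredT) => [|c]; last first.
  rewrite lem_addr /= addmC addmK; apply/eqP.
  by rewrite insubT ?bmdeg // => ad; congr Some; apply: val_inj.
apply: ler_sum => c _; rewrite fpsXM lem_addr -mulrA -exprD -mdegD addmC.
have -> : (BMultinom (hP c) - b)%MM = c :> 'X_{1..n} by rewrite /= addmC addmK.
by rewrite /= addmC.
Qed.

(** The product of X^b and [fps_quo b f] only keeps some of the coefficients of f, so M bounds it as
    well; [fps_psum_Xm] then allows division by r^d. *)
Lemma summable_quo d (b : 'X_{1..n < d.+1}) f r M :
  0 < r -> mdeg b = d -> summable_at f r M ->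
  summable_at (fps_quo b f) r (M / r ^+ d).
Proof.
move=> r0 bd fM e; rewrite ler_pdivlMr ?exprn_gt0 //.
have := fps_psum_Xm e (fps_quo b f) b (ltW r0); rewrite bd => /le_trans; apply.
apply: (@summable_le _ f r M (ltW r0)) => // a.
rewrite fpsXM; case: ifP => [ba|]; last by rewrite normr0.
by rewrite /= addmC submK //; case: ifP; rewrite ?normr0.
Qed.

(** For |a| >= k one has s^|a| <= (s / r)^k r^|a|: a germ of order k gains the factor (s / r)^k when
    the radius shrinks. *)
Lemma summable_ord k f r s M : 0 < s -> s <= r -> ordge k f ->
  summable_at f r M -> summable_at f s (M / r ^+ k * s ^+ k).
Proof.
move=> s0 sr fk fM d; have r0 : 0 < r by apply: lt_le_trans sr.
apply: le_trans (_ : fps_psum d f r / r ^+ k * s ^+ k <= _); last first.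
  by rewrite ler_wpM2r ?exprn_ge0 ?(ltW s0) // ler_wpM2r ?invr_ge0 ?exprn_ge0 ?(ltW r0) ?fM.
rewrite /fps_psum !mulr_suml; apply: ler_sum => a _.
have [ak|ka] := ltnP (mdeg a) k; first by rewrite fk // normr0 !mul0r.
rewrite -!mulrA ler_wpM2l // -(subnK ka) !exprD -mulrA [_ ^+ k * _]mulrA.
rewrite mulfV ?mul1r ?expf_neq0 ?gt_eqF // ler_wpM2r ?exprn_ge0 ?(ltW s0) //.
by apply: lerXn2r; rewrite ?nnegrE // ltW.
Qed.

Lemma convergentP f : reflect (exists r M, 0 < r /\ summable_at f r M) (f \in @convergent n K).
Proof. exact: asboolP. Qed.

(* The iterates of G on 0 are uniformly bounded and stabilise coefficientwise, so the
   formal fixed point inherits the bound; no completeness of K is involved. *)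
Lemma fps_fixpoint (I : Type) (G : (I -> fps n K) -> I -> fps n K) k r M :
    0 <= M ->
    (forall u i, (forall j, ordge k (u j)) -> ordge k (G u i)) ->
    (forall d u v, (k <= d)%N -> (forall j, ordge k (u j)) -> (forall j, ordge k (v j)) ->
       (forall j, ordge d (u j - v j)) -> forall i, ordge d.+1 (G u i - G v i)) ->
    (forall u, (forall j, ordge k (u j)) -> (forall j, summable_at (u j) r M) ->
       forall i, summable_at (G u i) r M) ->
  exists w : I -> fps n K,
    [/\ forall i, ordge k (w i), forall i, G w i = w i & forall i, summable_at (w i) r M].
Proof.
move=> M0 Gk Gc GM; pose u j : I -> fps n K := iter j G (fun=> 0).
have uk j i : ordge k (u j i) by elim: j i => [|j IH] i //=; apply: Gk.
have uM j i : summable_at (u j i) r M.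
  by elim: j i => [|j IH] i /=; [apply: summable0 | apply: GM].
have u1 j i : ordge (k + j) (u j.+1 i - u j i).
  elim: j i => [|j IH] i; first by rewrite addn0; apply: ordgeB.
  rewrite addnS; apply: (Gc _ (u j.+1) (u j)) => [||l|]; last exact: IH.
  - exact: leq_addr.
  - exact: uk j.+1.
  exact: uk.
have ud j l i : ordge (k + j) (u (j + l)%N i - u j i).
  elim: l => [|l IH]; first by rewrite addn0 subrr.
  rewrite addnS -[u _ i](subrK (u (j + l)%N i)) -addrA; apply: ordgeD => //.
  by apply: ordgeW (u1 _ i); rewrite leq_add2l leq_addr.
(* By [ud] the coefficients of degree below k + j are constant from iterate j on, so iterate |a| + 1
   already shows the final coefficient at a. *)
pose w i := Fps (fun a => u (mdeg a).+1 i a).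
have wu j i : ordge (k + j) (w i - u (k + j)%N i).
  move=> a ad; apply/eqP; rewrite fpsBE subr_eq0 /=; apply/eqP.
  have := ud (mdeg a).+1 (k + j - (mdeg a).+1)%N i a.
  rewrite subnKC // => /(_ _)/eqP; rewrite fpsBE subr_eq0 => /(_ _)/eqP -> //.
  by rewrite addnS ltnS leq_addl.
have wk i : ordge k (w i).
  rewrite -[w i](subrK (u k i)); apply: ordgeD => //.
  by have := wu 0%N i; rewrite addn0.
exists w; split=> // i.
  apply: ordge_eq => d; have -> : G w i - w i =
      (G w i - u (k + d).+1 i) - (w i - u (k + d).+1 i) by rewrite opprB addrA subrK.
  apply: ordgeB; last by rewrite -addnS; apply: ordgeW (wu _ i); rewrite addnS leqW ?leq_addl.
  apply: (@ordgeW _ _ _ (k + d).+1); first by rewrite leqW ?leq_addl.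
  by apply: Gc; rewrite ?leq_addr.
move=> d; apply: le_trans (uM (k + d)%N i d); apply: ler_sum => a _.
rewrite (ordge_sub (wu d i)) ?(leq_trans (bmdeg a)) ?leq_addl //.
Qed.

Lemma cpsME (f g : cps n K) : cps_fps (f * g) = cps_fps f * cps_fps g.
Proof. by []. Qed.

Lemma cps1E : cps_fps (1 : cps n K) = 1.
Proof. by []. Qed.

(** After division by f(0) the germ is 1 - h with h of order 1, and its inverse is the fixed point
    of w = 1 + h w. *)
Lemma cps_unitP (f : cps n K) : reflect (f 0%MM != 0) (f \is a GRing.unit).
Proof.
apply: (iffP idP) => [fu|f0].
  have E : fps_const (f^-1 : cps n K) * fps_const f = 1.
    by rewrite -rmorphM -cpsME mulVr // cps1E rmorph1.
  by apply: contra_eqN E => /eqP; rewrite /fps_const => ->; rewrite mulr0 eq_sym oner_eq0.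
pose h : fps n K := 1 - (f 0%MM)^-1 *: (f : fps n K).
have h1 : ordge 1 h by apply/ordge1; rewrite fpsBE fpsZE mulVf //= eqxx subrr.
have /convergentP[r [M [r0 hM]]] : h \in @convergent n K.
  by rewrite rpredB ?rpred1 // rpredZ //; case: (f).
have M0 := summable_ge0 hM.
(* At radius s the germ h is bounded by M s / r <= 1/2, so w |-> 1 + h w preserves the bound 2. *)
pose s := r / (1 + M *+ 2).
have D0 : 0 < 1 + M *+ 2 by rewrite ltr_wpDr ?mulrn_wge0.
have s0 : 0 < s by rewrite divr_gt0.
have sr : s <= r by rewrite ler_pdivrMr // ler_peMr ?(ltW r0) // lerDl mulrn_wge0.
have hs : summable_at h s (2%:R^-1).
  apply: summableW (summable_ord s0 sr h1 hM).
  rewrite !expr1 /s mulrA mulfVK ?gt_eqF // ler_pdivrMr //.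
  by rewrite mulrDr mulr1 -[M *+ 2]mulr_natl mulKf ?pnatr_eq0 // lerDr invr_ge0 ler0n.
have [|||w [_ wE wM]] := @fps_fixpoint unit (fun w _ => 1 + h * w tt) 0 s 2%:R (ler0n _ _).
- by [].
- move=> d u v _ _ _ uv i; rewrite opprD addrACA subrr add0r -mulrBr.
  by rewrite -add1n; apply: ordgeM.
- move=> u _ uM i; rewrite -[2%:R]/(1 + 1); apply: summableD; first exact: ltW.
    by have := @summableXm s 0%MM (ltW s0); rewrite mpolyX0 rmorph1 mdeg0.
  rewrite -(mulVf (_ : 2%:R != 0 :> K)) ?pnatr_eq0 //; apply: summableM => //.
  exact: ltW.
have wc : (f 0%MM)^-1 *: w tt \in @convergent n K.
  by apply: rpredZ; apply/convergentP; exists s, 2%:R.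
apply/unitrP; suff E : Cps wc * f = 1 by exists (Cps wc); rewrite [f * _]mulrC.
apply: val_inj; suff : (Cps wc : fps n K) * (f : fps n K) = 1 by [].
rewrite /cps_fps -/(cps_fps f) -scalerAl scalerAr.
have -> : (f 0%MM)^-1 *: (f : fps n K) = 1 - h by rewrite opprB addrC subrK.
by rewrite mulrBr mulr1 mulrC -{1}(wE tt) addrK.
Qed.

End Majorants.

(** * The perturbed Fermat polynomial *)

Section Germs.
Variables (n : nat) (K : numFieldType).
Implicit Types (f g h u : cps n K) (p q : {mpoly K[n]}) (a b c : 'X_{1..n}).

Lemma cpsDE f g : cps_fps (f + g) = cps_fps f + cps_fps g. Proof. by []. Qed.
Lemma cpsBE f g : cps_fps (f - g) = cps_fps f - cps_fps g. Proof. by []. Qed.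
Lemma cpsZE (k : K) f : cps_fps (k *: f) = k *: cps_fps f. Proof. by []. Qed.

Lemma cps_inj f g : cps_fps f = cps_fps g -> f = g.
Proof. exact: val_inj. Qed.

Lemma cps_sumE (I : Type) (r : seq I) (P : pred I) (F : I -> cps n K) :
  cps_fps (\sum_(i <- r | P i) F i) = \sum_(i <- r | P i) cps_fps (F i).
Proof. by elim/big_rec2: _ => // i x y _ <-. Qed.

Lemma cpsXE f k : cps_fps (f ^+ k) = cps_fps f ^+ k.
Proof. by elim: k => [|k IH]; rewrite ?expr0 // !exprS -IH. Qed.

Lemma cps_of_mpoly_additive : additive (@cps_of_mpoly n K).
Proof. by move=> p q; apply: cps_inj; apply: (raddfB (@fps_of_mpoly n K)). Qed.

Lemma cps_of_mpoly_multiplicative : multiplicative (@cps_of_mpoly n K).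
Proof.
split=> [p q|]; apply: cps_inj; first exact: (rmorphM (@fps_of_mpoly n K)).
exact: (rmorph1 (@fps_of_mpoly n K)).
Qed.

Lemma cps_of_mpoly_scalable : scalable (@cps_of_mpoly n K).
Proof. by move=> k p; apply: cps_inj; apply: fps_of_mpoly_scalable. Qed.

HB.instance Definition _ := GRing.isAdditive.Build {mpoly K[n]} (cps n K)
  (@cps_of_mpoly n K) cps_of_mpoly_additive.
HB.instance Definition _ := GRing.isMultiplicative.Build {mpoly K[n]} (cps n K)
  (@cps_of_mpoly n K) cps_of_mpoly_multiplicative.
HB.instance Definition _ := GRing.isScalable.Build K {mpoly K[n]} (cps n K) *:%R
  (@cps_of_mpoly n K) cps_of_mpoly_scalable.

Lemma cps_of_mpolyE p : cps_fps (cps_of_mpoly p) = fps_of_mpoly p.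
Proof. by []. Qed.

Lemma ideal_pow_ordge d f : ideal_pow (@maxideal n K) d f -> ordge d f.
Proof.
elim: d f => [|d IH] f //= [s sP ->]; rewrite cps_sumE big_seq.
apply: ordge_sum => y /sP[y1 /IH y2]; rewrite cpsME -add1n; apply: ordgeM => //.
by apply/ordge1.
Qed.

Lemma ideal_pow_Xm d a : mdeg a = d -> ideal_pow (@maxideal n K) d (cps_of_mpoly 'X_[a]).
Proof.
elim: d a => [|d IH] a // /mnm_split[i le_ia /IH ad].
exists [:: (cps_of_mpoly 'X_i, cps_of_mpoly 'X_[a - U_(i)])].
  move=> y; rewrite inE => /eqP -> /=; split=> //.
  by rewrite /maxideal /= mcoeffX mnm1_eq0.
by rewrite big_seq1 /= -rmorphM -mpolyXD addmC submK.
Qed.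

(** This turns the order of a germ into a finite algebraic expression with convergent coefficients,
    which any algebra morphism respects. *)
Lemma cps_decomp d f : ordge d f ->
  exists s : 'X_{1..n < d.+1} -> cps n K,
    f = \sum_(b : 'X_{1..n < d.+1} | mdeg b == d) cps_of_mpoly 'X_[b] * s b.
Proof.
move=> fd; have qc (b : 'X_{1..n < d.+1}) :
    (if mdeg b == d then fps_quo b f else 0) \in @convergent n K.
  case: eqP => [bd|_]; last exact: rpred0.
  have /convergentP[r [M [r0 fM]]] : (f : fps n K) \in @convergent n K by case: (f).
  by apply/convergentP; exists r, (M / r ^+ d); split=> //; apply: summable_quo.
exists (fun b : 'X_{1..n < d.+1} => Cps (qc b)); apply: cps_inj; rewrite cps_sumE.
by rewrite {1}(fps_decomp fd); apply: eq_bigr => b bd; rewrite cpsME /= bd.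
Qed.

Lemma cps_decomp1 f : f 0%MM = 0 ->
  exists s : 'I_n -> cps n K, f = \sum_i cps_of_mpoly 'X_i * s i.
Proof.
move=> /ordge1/cps_decomp[s ->].
have U1 (i : 'I_n) : (mdeg U_(i)%MM < 2)%N by rewrite mdeg1.
pose U i := BMultinom (U1 i); exists (fun i => s (U i)).
rewrite (eq_bigl (fun b : 'X_{1..n < 2} => b \in [set U i | i in 'I_n])) => [|b].
  by rewrite big_imset //= => i j _ _ /eqP; rewrite bmeqP /= eq_mnm1 => /eqP.
apply/mdeg1P/imsetP => [[i /eqP ib]|[i _ ->]]; exists i => //.
by apply/eqP; rewrite bmeqP /= ib.
Qed.

(** * Algebra morphisms and their Jacobian matrices *)

Section Morphism.
Variable phi : {lrmorphism cps n K -> cps n K}.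

Lemma lrmorph_const (k : K) : phi k%:A = k%:A.
Proof. by rewrite linearZ /= rmorph1. Qed.

(* Otherwise, for k := (phi f)(0), the germ f - k would be a unit but not its image. *)
Lemma lrmorph_maxideal f : f 0%MM = 0 -> phi f 0%MM = 0.
Proof.
move=> f0; set k := phi f 0%MM; apply/eqP; apply: contraT => k0.
have Ak : (k%:A : cps n K) 0%MM = k by rewrite cpsZE cps1E fpsZE /= eqxx mulr1.
have : phi (f - k%:A) \is a GRing.unit.
  apply: rmorph_unit; apply/cps_unitP.
  by rewrite cpsBE fpsBE f0 Ak sub0r oppr_eq0.
rewrite rmorphB /= lrmorph_const => /cps_unitP.
by rewrite cpsBE fpsBE Ak subrr eqxx.
Qed.

Let y k : fps n K := phi (cps_of_mpoly 'X_k).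
Let J : 'M[fps n K]_n := \matrix_(k, l) fps_deriv l (y k).

(** Write psi(x_j) as a constant plus sum_i x_i s_ji. Applying phi gives x_j as a constant plus
    sum_i y_i phi(s_ji); since y_i(0) = 0, differentiating at 0 yields L J(0) = 1 by the product
    rule alone. *)
Lemma jacobian_unit : bijective phi -> \det J 0%MM != 0.
Proof.
case=> psi _ psiK.
have y0 k : y k 0%MM = 0.
  by apply: lrmorph_maxideal; rewrite /= mcoeffX mnm1_eq0.
have sP j : exists s : 'I_n -> cps n K, psi (cps_of_mpoly 'X_j) =
    (psi (cps_of_mpoly 'X_j) 0%MM)%:A + \sum_i cps_of_mpoly 'X_i * s i.
  set f := psi _; have [|s sE] := @cps_decomp1 (f - (f 0%MM)%:A).
    by rewrite cpsBE cpsZE cps1E fpsBE fpsZE /= eqxx mulr1 subrr.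
  by exists s; rewrite -sE addrC subrK.
have {sP} [s sP] := choice sP.
pose L : 'M[K]_n := \matrix_(j, k) (phi (s j k)) 0%MM.
have /mulmx1_unit[_] : L *m map_mx (@fps_const n K) J = 1%:M.
  apply/matrixP => j l; rewrite !mxE.
  set k0 := psi (cps_of_mpoly 'X_j) 0%MM in sP.
  have E : cps_of_mpoly 'X_j = k0%:A + \sum_i phi (cps_of_mpoly 'X_i) * phi (s j i).
    rewrite -[LHS]psiK sP rmorphD /= lrmorph_const rmorph_sum; congr (_ + _).
    by apply: eq_bigr => i _; rewrite rmorphM.
  have : fps_deriv l (cps_of_mpoly 'X_j : cps n K) 0%MM = (j == l)%:R.
    by rewrite fps_deriv_const /= mcoeffX eq_mnm1.
  rewrite E cpsDE cps_sumE fps_derivD fpsDE fps_deriv_sum fps_sumE.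
  rewrite fps_deriv_const cpsZE cps1E fpsZE fps1E mnm1_eq0 mulr0 add0r => <-.
  apply: eq_bigr => k _; rewrite cpsME fps_derivM fpsDE !fpsM0 -/(y k) y0 mul0r addr0.
  by rewrite !mxE mulrC.
by rewrite unitmxE det_map_mx unitfE.
Qed.

End Morphism.

(** * The obstruction to contact equivalence *)

Section NotEquivalent.
Variable m : nat.
Hypotheses (m_ge3 : (3 <= m)%N) (N_gtm : (m < n * (m - 2))%N).

Definition fermat_top : 'X_{1..n} := [multinom (m - 2)%N | i < n].

Lemma mdeg_fermat_top : mdeg fermat_top = (n * (m - 2))%N.
Proof.
rewrite mdegE (eq_bigr (fun=> (m - 2)%N)) => [|i _]; last by rewrite mnmE.
by rewrite sum_nat_const card_ord.
Qed.

Lemma fermatE : fermat n K m = \sum_(i < n) 'X_[U_(i) *+ m].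
Proof. by apply: eq_bigr => i _; rewrite mpolyXn. Qed.

Let g := fermat n K m + 'X_[fermat_top].

Lemma fermat_topB l : (U_(l) <= fermat_top)%MM.
Proof. by rewrite lep1mP mnmE subn_eq0 -ltnNge. Qed.

Lemma deriv_fermat l : (fermat n K m)^`M(l) = m%:R *: 'X_[U_(l) *+ m.-1].
Proof.
rewrite fermatE (raddf_sum (mderiv l)) (bigD1 l) //= big1 ?addr0 => [|i il].
  rewrite mderivX mulmnE mnm1E eqxx mul1n; congr (_ *: 'X_[_]).
  apply/mnmP => i; rewrite mnmBE !mulmnE mnm1E; case: eqP => // _.
  by rewrite !mul1n subn1.
by rewrite mderivX mulmnE mnm1E (negbTE il) scale0r.
Qed.

Lemma deriv_fermat_top l :
  g^`M(l) = m%:R *: 'X_[U_(l) *+ m.-1] + (m - 2)%:R *: 'X_[fermat_top - U_(l)].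
Proof. by rewrite mderivD mderivX mnmE deriv_fermat. Qed.

(** A weight argument: the monomials x_j^m force on each x_j the weight v(0) / m, whence w has
    weight N v(0) / m, but the relation requires v(0). *)
Lemma fermat_top_not_tjurina (v : fps n K) (b : 'I_n -> fps n K) :
    (forall l, b l 0%MM = 0) ->
    v * fps_of_mpoly g = \sum_l b l * fps_of_mpoly g^`M(l) ->
  v 0%MM = 0.
Proof.
move=> b0 E.
have EL a : (v * fps_of_mpoly g) a =
    \sum_i (v * fps_of_mpoly 'X_[U_(i) *+ m]) a + (v * fps_of_mpoly 'X_[fermat_top]) a.
  by rewrite rmorphD fermatE rmorph_sum mulrDr mulr_sumr fpsDE fps_sumE.
have ER a : (\sum_l b l * fps_of_mpoly g^`M(l)) a =
    \sum_l (m%:R * (b l * fps_of_mpoly 'X_[U_(l) *+ m.-1]) a +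
            (m - 2)%:R * (b l * fps_of_mpoly 'X_[fermat_top - U_(l)]) a).
  rewrite fps_sumE; apply: eq_bigr => l _.
  have -> : fps_of_mpoly g^`M(l) = m%:R *: fps_of_mpoly 'X_[U_(l) *+ m.-1]
      + (m - 2)%:R *: fps_of_mpoly 'X_[fermat_top - U_(l)].
    by rewrite deriv_fermat_top linearD !linearZ.
  by rewrite mulrDr -!scalerAr fpsDE !fpsZE.
have Um i k : mdeg (U_(i) *+ k : 'X_{1..n})%MM = k by rewrite mdegMn mdeg1 mul1n.
have le_mdeg (a c : 'X_{1..n}) : (a <= c)%MM -> (mdeg a <= mdeg c)%N.
  by move=> /submK <-; rewrite mdegD leq_addl.
have Ej j : v 0%MM = m%:R * b j U_(j)%MM.
  have : (v * fps_of_mpoly g) (U_(j) *+ m)%MM =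
    (\sum_l b l * fps_of_mpoly g^`M(l)) (U_(j) *+ m)%MM by rewrite E.
  rewrite EL ER.
  rewrite (bigD1 j) // [X in (_ + X) + _]big1 => [|i ij]; last first.
    rewrite fpsMX ifF //; apply/negP => /mnm_lepP/(_ i).
    by rewrite !mulmnE !mnm1E eqxx eq_sym (negbTE ij) mul1n leqNgt (ltn_trans _ m_ge3).
  rewrite fpsMX lepm_refl addr0 fpsMX ifF ?addr0 => [|]; last first.
    apply/negP => /le_mdeg; rewrite mdeg_fermat_top Um.
    by rewrite leqNgt N_gtm.
  have -> : (U_(j) *+ m - U_(j) *+ m = 0)%MM by apply/mnmP => i; rewrite mnmBE mnm0E subnn.
  (* The monomial w / x_l has degree N - 1 >= m, so it divides x_j^m only if they are equal, and
     then the coefficient is b_l(0) = 0. *)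
  move=> ->; have bw l : (b l * fps_of_mpoly 'X_[fermat_top - U_(l)]) (U_(j) *+ m)%MM = 0.
    rewrite fpsMX; case: ifP => // le; rewrite (_ : (_ - _)%MM = 0%MM) ?b0 //.
    have := congr1 (@mdeg n) (submK le); rewrite mdegD Um => D1.
    have := congr1 (@mdeg n) (submK (fermat_topB l)).
    rewrite mdegD mdeg1 mdeg_fermat_top => D2.
    apply/eqP; rewrite -mdeg_eq0; apply/eqP.
    by move: N_gtm D1 D2; move: (mdeg _) (mdeg _) (n * _)%N => x z t; lia.
  rewrite (bigD1 j) // big1 => [|l lj]; last first.
    rewrite bw mulr0 addr0 fpsMX ifF ?mulr0 //; apply/negP => /mnm_lepP/(_ l).
    rewrite !mulmnE !mnm1E eqxx eq_sym (negbTE lj) mul1n mul0n leqNgt.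
    by rewrite -ltnS prednK ?(leq_trans _ m_ge3).
  rewrite bw mulr0 Monoid.mulm1 addr0 fpsMX ifT; last first.
    by apply/mnm_lepP => i; rewrite !mulmnE leq_mul2l leq_pred orbT.
  congr (_ * b j _); apply/mnmP => i; rewrite mnmBE !mulmnE -mulnBr.
  by rewrite (_ : m - m.-1 = 1)%N ?muln1 //; lia.
(* All exponents of w are m - 2, so neither x_i^m nor x_l^(m-1) divides w; only the terms coming
   from w itself survive. *)
have Ew : v 0%MM = (m - 2)%:R * \sum_l b l U_(l)%MM.
  have : (v * fps_of_mpoly g) fermat_top =
    (\sum_l b l * fps_of_mpoly g^`M(l)) fermat_top by rewrite E.
  rewrite EL ER.
  rewrite big1 => [|i _]; last first.
    rewrite fpsMX ifF //; apply/negP => /mnm_lepP/(_ i).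
    by rewrite mulmnE mnm1E eqxx mul1n mnmE leqNgt ltn_subrL (ltn_trans _ m_ge3).
  rewrite add0r fpsMX lepm_refl.
  have -> : (fermat_top - fermat_top = 0)%MM by apply/mnmP => i; rewrite mnmBE mnm0E subnn.
  move=> ->; rewrite mulr_sumr; apply: eq_bigr => l _.
  rewrite fpsMX ifF ?mulr0 ?add0r => [|]; last first.
    apply/negP => /mnm_lepP/(_ l); rewrite mulmnE mnm1E eqxx mul1n mnmE.
    by move: m_ge3; lia.
  by rewrite fpsMX lem_subr submBA ?fermat_topB // addmC addmK.
have : (n * (m - 2))%:R * v 0%MM = m%:R * v 0%MM.
  rewrite {2}Ew mulrCA mulr_sumr natrM [n%:R * _]mulrC -mulrA; congr (_ * _).
  rewrite (eq_bigr (fun=> v 0%MM)) => [|l _]; last exact/esym/Ej.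
  by rewrite sumr_const card_ord mulr_natl.
move/eqP; rewrite -subr_eq0 -mulrBl mulf_eq0 subr_eq0 eqr_nat gtn_eqF //=.
by move/eqP.
Qed.

Lemma fermat_top_not_contact :
  ~ contact_equiv (cps_of_mpoly (fermat n K m)) (cps_of_mpoly g).
Proof.
case=> phi phi_bij [u uU phiE].
pose y k : fps n K := phi (cps_of_mpoly 'X_k).
pose J : 'M[fps n K]_n := \matrix_(k, l) fps_deriv l (y k).
have dJ : \det J 0%MM != 0 by apply: jacobian_unit.
have y0 k : y k 0%MM = 0.
  by apply: lrmorph_maxideal; rewrite /= mcoeffX mnm1_eq0.
set G := fps_of_mpoly g.
have E : \sum_k y k ^+ m = (u : fps n K) * G.
  have := congr1 (@cps_fps n K) phiE; rewrite cpsME => <-.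
  rewrite /fermat !rmorph_sum /= cps_sumE; apply: eq_bigr => k _.
  by rewrite !rmorphXn /= cpsXE.
(* By the adjugate, J a = (det J) y: up to the unit det J, this is the Euler field of the
   coordinates y expressed in the coordinates x. *)
pose a l : fps n K := \sum_k (\adj J) l k * y k.
have Ea : (\det J * (\sum_k y k ^+ m)) *+ m =
    \sum_l fps_deriv l (\sum_k y k ^+ m) * a l.
  transitivity (\sum_k (\det J * y k ^+ m.-1 * y k) *+ m).
    rewrite mulr_sumr sumrMnl; congr (_ *+ _); apply: eq_bigr => k _.
    by rewrite -mulrA -exprSr prednK ?(leq_trans _ m_ge3).
  pose p : 'rV[fps n K]_n := \row_k y k ^+ m.-1.
  have pE k : \det J * y k ^+ m.-1 = \sum_l (p *m J) 0 l * (\adj J) l k.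
    have /matrixP/(_ 0 k) : p *m J *m \adj J = \det J *: p.
      by rewrite -mulmxA mul_mx_adj mul_mx_scalar.
    by rewrite !mxE => <-.
  have DE l : fps_deriv l (\sum_k y k ^+ m) = (p *m J) 0 l *+ m.
    rewrite fps_deriv_sum mxE -sumrMnl; apply: eq_bigr => k _; rewrite !mxE.
    by rewrite -{1}(prednK (leq_trans _ m_ge3)) // fps_derivX prednK ?(leq_trans _ m_ge3).
  under eq_bigr do rewrite pE mulr_suml -sumrMnl.
  rewrite exchange_big; apply: eq_bigr => l _; rewrite DE mulr_sumr.
  by apply: eq_bigr => k _; rewrite mulrnAl mulrA.
(* In the product rule for u g the terms with derivatives of u move to the left. As a_l(0) = 0, they
   leave v(0) = m u(0) (det J)(0), which is nonzero. *)
pose v := (\det J * (u : fps n K)) *+ m - \sum_l fps_deriv l u * a l.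
have /eqP : v 0%MM = 0.
  apply: (@fermat_top_not_tjurina _ (fun l => (u : fps n K) * a l)) => [l|].
    rewrite fpsM0 fps_sumE big1 ?mulr0 // => k _.
    by rewrite fpsM0 y0 mulr0.
  move: Ea; rewrite E mulrA -mulrnAl mulrBl => ->; rewrite mulr_suml -sumrB.
  apply: eq_bigr => l _; rewrite fps_derivM -fps_deriv_mpoly -/G.
  ring.
rewrite /v fpsBE fps_sumE [X in _ - X]big1 => [|l _]; last first.
  rewrite fpsM0 fps_sumE big1 ?mulr0 // => k _.
  by rewrite fpsM0 y0 mulr0.
rewrite subr0 -mulr_natr fpsM0 fpsM0 !mulf_eq0 (negbTE dJ) (negbTE (elimT (cps_unitP u) uU)).
rewrite -/(fps_const _) rmorph_nat pnatr_eq0 /=.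
by case: (m) m_ge3.
Qed.

End NotEquivalent.

End Germs.

(** * Substitution and the inverse function theorem *)

Lemma mulr_subM (R : comPzRingType) (a b c d : R) :
  a * b - c * d = (a - c) * b + c * (b - d).
Proof. by rewrite mulrBl mulrBr addrA subrK. Qed.

Section Substitution.
Variables (n : nat) (K : numFieldType).
Implicit Types (f g : fps n K) (p q : {mpoly K[n]}) (a b : 'X_{1..n}).
Implicit Types (y z u v : 'I_n -> fps n K).

Lemma mnm_ind (P : 'X_{1..n} -> Prop) :
  P 0%MM -> (forall i a, P a -> P (U_(i) + a)%MM) -> forall a, P a.
Proof.
move=> P0 PS a; move: {2}(mdeg a) (erefl (mdeg a)) => d.
elim: d a => [|d IH] a; first by move/eqP; rewrite mdeg_eq0 => /eqP ->.
by case/mnm_split=> i le_ia /IH; rewrite -{2}(submK le_ia) addmC; apply: PS.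
Qed.

Definition fps_eval y : {mpoly K[n]} -> fps n K := mmap (in_alg (fps n K)) y.

HB.instance Definition _ y := GRing.RMorphism.on (fps_eval y).

Lemma fps_evalX y a : fps_eval y 'X_[a] = mmap1 y a.
Proof. exact: mmapX. Qed.

Lemma fps_evalXU y i : fps_eval y 'X_i = y i.
Proof. by rewrite fps_evalX mmap1U. Qed.

Lemma fps_evalZ y k p : fps_eval y (k *: p) = k *: fps_eval y p.
Proof. by rewrite /fps_eval mmapZ /= mulr_algl. Qed.

Lemma fps_evalE y p : fps_eval y p = \sum_(a <- msupp p) p@_a *: mmap1 y a.
Proof. by apply: eq_bigr => a _; rewrite /= mulr_algl. Qed.

Lemma mmap1S y i a : mmap1 y (U_(i) + a)%MM = y i * mmap1 y a.
Proof. by rewrite -!fps_evalX mpolyXD rmorphM /= fps_evalXU. Qed.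

Lemma ordge_mmap1 y a : (forall i, ordge 1 (y i)) -> ordge (mdeg a) (mmap1 y a).
Proof.
move=> y1; elim/mnm_ind: a => [|i a IH]; first by rewrite mdeg0; apply: ordge0.
by rewrite mmap1S mdegD mdeg1; apply: ordgeM.
Qed.

(** Replacing y by z one factor at a time, each difference has one factor of order d + 1 and |a| - 1
    factors of order at least 1. *)
Lemma ordge_mmap1B d y z a : (forall i, ordge 1 (y i)) -> (forall i, ordge 1 (z i)) ->
  (forall i, ordge d.+1 (y i - z i)) -> ordge (d + mdeg a) (mmap1 y a - mmap1 z a).
Proof.
move=> y1 z1 yz; elim/mnm_ind: a => [|i a IH]; first by rewrite !mmap11 subrr.
rewrite !mmap1S mulr_subM.
rewrite mdegD mdeg1 addnA addn1; apply: ordgeD; first by apply: ordgeM (yz _) (ordge_mmap1 y1).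
by rewrite -[d.+1]add1n -addnA; apply: ordgeM (z1 _) IH.
Qed.

Lemma ordge_eval d y p : (forall i, ordge 1 (y i)) ->
  (forall a, (mdeg a < d)%N -> p@_a = 0) -> ordge d (fps_eval y p).
Proof.
move=> y1 pd; rewrite fps_evalE; apply: ordge_sum => a _.
have [ad|da] := ltnP (mdeg a) d; first by rewrite pd // scale0r.
by apply: ordgeZ; apply: ordgeW da (ordge_mmap1 y1).
Qed.

Lemma fps_eval_trunc y d f :
  fps_eval y (fps_trunc d f) = \sum_(b : 'X_{1..n < d}) f b *: mmap1 y b.
Proof.
by rewrite rmorph_sum /=; apply: eq_bigr => b _; rewrite fps_evalZ fps_evalX.
Qed.

(** When the y i have no constant term, only the part of f of degree at most |a| reaches the
    coefficient at a; the definition is total but meant for such y. *)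
Definition fps_subst y f : fps n K :=
  Fps (fun a => fps_eval y (fps_trunc (mdeg a).+1 f) a).

Section Series.
Variable y : 'I_n -> fps n K.
Hypothesis y1 : forall i, ordge 1 (y i).

Lemma fps_substE d f p a : (mdeg a < d)%N ->
  (forall b, (mdeg b < d)%N -> p@_b = f b) -> fps_subst y f a = fps_eval y p a.
Proof.
move=> ad pf; apply: (@ordge_sub n K (mdeg a).+1 (fps_eval y _)) => //.
rewrite -rmorphB.
apply: ordge_eval => // b ba; rewrite mcoeffB fps_truncE // pf ?subrr //.
by apply: leq_trans ad.
Qed.

Lemma fps_subst_trunc d f a : (mdeg a < d)%N ->
  fps_eval y (fps_trunc d f) a = fps_subst y f a.
Proof. by move=> ad; apply/esym/(fps_substE ad) => b; apply: fps_truncE. Qed.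

Lemma fps_subst_mpoly p : fps_subst y (fps_of_mpoly p) = fps_eval y p.
Proof. by apply: fpsP => a; apply: (@fps_substE (mdeg a).+1). Qed.

Lemma fps_substD f g : fps_subst y (f + g) = fps_subst y f + fps_subst y g.
Proof.
apply: fpsP => a; set d := (mdeg a).+1.
have trD : fps_trunc d (f + g) = fps_trunc d f + fps_trunc d g.
  by rewrite -big_split /=; apply: eq_bigr => b _; rewrite -scalerDl.
have Ed : fps_eval y (fps_trunc d (f + g)) a =
    fps_eval y (fps_trunc d f) a + fps_eval y (fps_trunc d g) a.
  by rewrite trD rmorphD.
exact: Ed.
Qed.

Lemma fps_substM f g : fps_subst y (f * g) = fps_subst y f * fps_subst y g.
Proof.
apply: fpsP => a; set d := (mdeg a).+1.
have E h : ordge d (fps_subst y h - fps_eval y (fps_trunc d h)).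
  by move=> b bd; rewrite fpsBE (fps_subst_trunc _ bd) subrr.
have -> : fps_subst y (f * g) a = fps_eval y (fps_trunc d f * fps_trunc d g) a.
  by apply: (@fps_substE d) => // b bd; rewrite -fpsME.
rewrite rmorphM; apply/esym/(@ordge_sub _ _ d) => //.
rewrite mulr_subM.
by apply: ordgeD; [apply: ordgeMr | apply: ordgeMl].
Qed.

Lemma fps_subst1 : fps_subst y 1 = 1.
Proof. by rewrite -(rmorph1 (@fps_of_mpoly n K)) fps_subst_mpoly !rmorph1. Qed.

Lemma fps_substZ k f : fps_subst y (k *: f) = k *: fps_subst y f.
Proof.
have kE : k%:A = fps_of_mpoly (k%:MP) :> fps n K.
  by rewrite -alg_mpolyC fps_of_mpoly_scalable rmorph1.
rewrite -mulr_algl fps_substM kE fps_subst_mpoly -alg_mpolyC fps_evalZ rmorph1.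
by rewrite mulr_algl.
Qed.

Lemma fps_substN f : fps_subst y (- f) = - fps_subst y f.
Proof. by rewrite -scaleN1r fps_substZ scaleN1r. Qed.

Lemma ordge_subst d f : ordge d f -> ordge d (fps_subst y f).
Proof.
move=> fd a ad; rewrite (@fps_substE d f 0) ?rmorph0 // => b bd.
by rewrite mcoeff0 fd.
Qed.

Lemma summable_mmap1 r s a : 0 <= r -> (forall i, summable_at (y i) r s) ->
  summable_at (mmap1 y a) r (s ^+ mdeg a).
Proof.
move=> r0 ys; elim/mnm_ind: a => [|i a IH].
  rewrite mmap11 mdeg0 expr0; have := @summableXm n K r 0%MM r0.
  by rewrite mpolyX0 rmorph1 mdeg0.
by rewrite mmap1S mdegD mdeg1 exprS; apply: summableM.
Qed.

(** Majorant form of composition: y^a is bounded by s^|a| at radius r, so a bound for f at radius s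
    passes to f(y) at radius r. *)
Lemma summable_subst r s f M : 0 <= r -> 0 <= s -> (forall i, summable_at (y i) r s) ->
  summable_at f s M -> summable_at (fps_subst y f) r M.
Proof.
move=> r0 s0 ys fM d.
have E : summable_at (fps_eval y (fps_trunc d f)) r
    (\sum_(b : 'X_{1..n < d}) `|f b| * s ^+ mdeg b).
  rewrite fps_eval_trunc; apply: summable_sum => // b _.
  by apply: summableZ; apply: summable_mmap1.
apply: le_trans (fM d); apply: le_trans (E d); apply: ler_sum => a _.
by rewrite -(fps_subst_trunc _ (bmdeg a)).
Qed.

End Series.

Lemma ordge_substB d e y z f : (forall i, ordge 1 (y i)) -> (forall i, ordge 1 (z i)) ->
  (forall i, ordge d.+1 (y i - z i)) -> ordge e f ->
  ordge (d + e) (fps_subst y f - fps_subst z f).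
Proof.
move=> y1 z1 yz fe a ad.
rewrite fpsBE /= -fpsBE.
rewrite !fps_eval_trunc -sumrB fps_sumE big1 // => b _.
rewrite -scalerBr fpsZE.
have [be|eb] := ltnP (mdeg b) e; first by rewrite fe ?mul0r.
rewrite (ordge_mmap1B y1 z1 yz) ?mulr0 //.
by apply: leq_trans ad _; rewrite leq_add2l.
Qed.

(** The inverse of 1 + sum_i 1 / r_i stands in for the minimum of the r_i, which avoids comparing
    them in the partially ordered field K. *)
Lemma common_radius (I : finType) (P : I -> K -> Prop) :
    (forall i, exists2 r, 0 < r & forall t, 0 < t -> t <= r -> P i t) ->
  exists2 r, 0 < r & forall i t, 0 < t -> t <= r -> P i t.
Proof.
move=> rP; have /choice[r {}rP] : forall i, exists r, 0 < r /\ forall t, 0 < t -> t <= r -> P i t.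
  by move=> i; have [r r0 rP'] := rP i; exists r.
have r0 i : 0 < r i by have [] := rP i.
have S0 : 0 < 1 + \sum_i (r i)^-1.
  by rewrite ltr_wpDr // sumr_ge0 // => i _; rewrite invr_ge0 ltW.
exists (1 + \sum_i (r i)^-1)^-1; first by rewrite invr_gt0.
move=> i t t0 tr; have [_] := rP i; apply=> //; apply: le_trans tr _.
rewrite -[leRHS]invrK lef_pV2 ?posrE ?invr_gt0 // (bigD1 i) //= addrCA lerDl.
by rewrite addr_ge0 ?sumr_ge0 // => j _; rewrite invr_ge0 ltW.
Qed.

Lemma cps_small (f : cps n K) k : ordge k f ->
  exists2 r : K, 0 < r & exists2 M : K, 0 <= M &
    forall t, 0 < t -> t <= r -> summable_at f t (M * t ^+ k).
Proof.
move=> fk; have /convergentP[r [M [r0 fM]]] : (f : fps n K) \in @convergent n K by case: (f).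
exists r => //; exists (M / r ^+ k); first by rewrite divr_ge0 ?exprn_ge0 ?(summable_ge0 fM) // ltW.
by move=> t t0 tr; apply: summable_ord.
Qed.

Lemma cps_small_family (I : finType) (F : I -> cps n K) k : (forall i, ordge k (F i)) ->
  exists2 r : K, 0 < r & exists2 M : K, 0 <= M &
    forall i t, 0 < t -> t <= r -> summable_at (F i) t (M * t ^+ k).
Proof.
move=> Fk; pose P i t := summable_at (F i) t.
have /choice[M MP] : forall i, exists M : K, 0 <= M /\ exists2 r, 0 < r &
    forall t, 0 < t -> t <= r -> summable_at (F i) t (M * t ^+ k).
  by move=> i; have [r r0 [M M0 fM]] := cps_small (Fk i); exists M; split=> //; exists r.
have [i|r r0 rP] := @common_radius I (fun i t => summable_at (F i) t (M i * t ^+ k)).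
  by have [] := MP i.
exists r => //; exists (\sum_i M i); first by apply: sumr_ge0 => i _; have [] := MP i.
move=> i t t0 tr; apply: summableW (rP i t t0 tr).
rewrite ler_wpM2r ?exprn_ge0 ?(ltW t0) // (bigD1 i) //= lerDl sumr_ge0 // => j _.
by have [] := MP j.
Qed.

Section Germs.
Variable y : 'I_n -> cps n K.
Hypothesis y1 : forall i, ordge 1 (y i).

Lemma convergent_subst (f : cps n K) : fps_subst (fun i => y i) f \in @convergent n K.
Proof.
have /convergentP[s [N [s0 fN]]] : (f : fps n K) \in @convergent n K by case: (f).
have [r r0 [M M0 yM]] := cps_small_family y1.
(* Chosen so that t <= r and M t <= s. *)
pose t := r / (1 + r * M / s).
have D0 : 0 < 1 + r * M / s.
  by rewrite ltr_wpDr // divr_ge0 ?mulr_ge0 // ltW.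
have t0 : 0 < t by rewrite divr_gt0.
apply/convergentP; exists t, N; split=> //.
apply: summable_subst fN => [//|||i]; [exact: ltW|exact: ltW|].
apply: summableW (yM i t t0 _); last first.
  by rewrite ler_pdivrMr // ler_peMr ?(ltW r0) // lerDl divr_ge0 ?mulr_ge0 // ltW.
rewrite expr1 /t mulrA ler_pdivrMr // mulrDr mulr1 mulrCA mulfV ?gt_eqF // mulr1.
by rewrite [M * r]mulrC lerDr ltW.
Qed.

Definition cps_subst (f : cps n K) : cps n K := Cps (convergent_subst f).

Lemma cps_subst_additive : additive cps_subst.
Proof.
by move=> f g; apply: cps_inj; rewrite /= fps_substD // fps_substN.
Qed.

Lemma cps_subst_multiplicative : multiplicative cps_subst.
Proof.
by split=> [f g|]; apply: cps_inj; [apply: fps_substM | apply: fps_subst1].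
Qed.

Lemma cps_subst_scalable : scalable cps_subst.
Proof. by move=> k f; apply: cps_inj; apply: fps_substZ. Qed.

HB.instance Definition _ := GRing.isAdditive.Build (cps n K) (cps n K)
  cps_subst cps_subst_additive.
HB.instance Definition _ := GRing.isMultiplicative.Build (cps n K) (cps n K)
  cps_subst cps_subst_multiplicative.
HB.instance Definition _ := GRing.isScalable.Build K (cps n K) (cps n K) *:%R
  cps_subst cps_subst_scalable.

Definition cps_subst_morphism : {lrmorphism cps n K -> cps n K} := cps_subst.

Lemma cps_subst_mpoly p :
  cps_fps (cps_subst_morphism (cps_of_mpoly p)) = fps_eval (fun i => y i) p.
Proof. exact: fps_subst_mpoly. Qed.

End Germs.

(** Continuity is automatic: a morphism preserves the maximal ideal, hence by [cps_decomp] the order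
    of germs. Agreement on polynomials therefore extends to all germs modulo every order. *)
Lemma lrmorph_ext (phi psi : {lrmorphism cps n K -> cps n K}) :
  (forall i, phi (cps_of_mpoly 'X_i) = psi (cps_of_mpoly 'X_i)) -> phi =1 psi.
Proof.
move=> E.
have X1 (chi : {lrmorphism cps n K -> cps n K}) a : ordge (mdeg a) (chi (cps_of_mpoly 'X_[a])).
  elim/mnm_ind: a => [|i a IH]; first by rewrite mdeg0; apply: ordge0.
  rewrite mpolyXD !rmorphM mdegD mdeg1 cpsME; apply: ordgeM => //.
  by apply/ordge1/lrmorph_maxideal; rewrite /= mcoeffX mnm1_eq0.
have EX a : phi (cps_of_mpoly 'X_[a]) = psi (cps_of_mpoly 'X_[a]).
  elim/mnm_ind: a => [|i a IH]; first by rewrite mpolyX0 !rmorph1.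
  by rewrite mpolyXD !rmorphM /= E IH.
have Ep p : phi (cps_of_mpoly p) = psi (cps_of_mpoly p).
  rewrite [p]mpolyE !rmorph_sum /=; apply: eq_bigr => a _.
  by rewrite cps_of_mpoly_scalable !linearZ /= EX.
have hi (chi : {lrmorphism cps n K -> cps n K}) d (f : cps n K) :
    ordge d f -> ordge d (chi f).
  move=> /cps_decomp[s ->]; rewrite rmorph_sum cps_sumE; apply: ordge_sum => b /eqP bd.
  by rewrite rmorphM cpsME; apply: ordgeMr; rewrite -{1}bd; apply: X1.
move=> f; apply: cps_inj; apply: ordge_eq => d.
pose t := cps_of_mpoly (fps_trunc d f).
have ft : ordge d (f - t : cps n K) by apply: ordge_trunc.
have D (chi : {lrmorphism cps n K -> cps n K}) :
    cps_fps (chi (f - t)) = cps_fps (chi f) - cps_fps (chi t) by rewrite rmorphB.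
have -> : cps_fps (phi f) - cps_fps (psi f) = cps_fps (phi (f - t)) - cps_fps (psi (f - t)).
  by rewrite !D Ep opprB addrA subrK.
by apply: ordgeB; apply: hi.
Qed.

(** For z = x + w the equation reads z + c(z) = x. It is contracting since c has order 2: changing w
    in order d changes c(x + w) in order d + 1. *)
Lemma inverse_series (c : 'I_n -> cps n K) : (forall i, ordge 2 (c i)) ->
  exists2 w : 'I_n -> cps n K, forall i, ordge 2 (w i) &
    forall i, (w i : fps n K) =
      - fps_subst (fun j => fps_of_mpoly 'X_j + (w j : fps n K)) (c i).
Proof.
move=> c2; have [s s0 [L L0 cL]] := cps_small_family c2.
(* If w is bounded by r at radius r, then x + w is bounded by 2r and c(x + w) by L (2r)^2 = (4 L r)
   r. This r ensures 4 L r <= 1 and 2r <= s. *)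
pose r := (1 + 4%:R * L + 2%:R / s)^-1.
have D0 : 0 < 1 + 4%:R * L + 2%:R / s.
  by rewrite -addrA ltr_wpDr // addr_ge0 ?mulr_ge0 ?invr_ge0 ?ler0n // ltW.
have r0 : 0 < r by rewrite invr_gt0.
have rL : 4%:R * L * r <= 1.
  rewrite ler_pdivrMr // mul1r addrAC lerDr addr_ge0 ?mulr_ge0 ?invr_ge0 ?ler0n //.
  exact: ltW.
have rs : 2%:R * r <= s.
  rewrite ler_pdivrMr // mulrDr [s * (_ / s)]mulrC mulfVK ?gt_eqF // lerDr.
  by rewrite mulr_ge0 ?(ltW s0) // addr_ge0 ?mulr_ge0 ?ler0n.
pose X j : fps n K := fps_of_mpoly 'X_j.
have X1 j : ordge 1 (X j) by rewrite -(mdeg1 j); apply: ordgeX.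
have Xu u j : (forall j, ordge 2 (u j)) -> ordge 1 (X j + u j).
  by move=> u2; apply: ordgeD => //; apply: ordgeW (u2 j).
pose G u i := - fps_subst (fun j => X j + u j) (c i).
have [|||w [w2 wE wr]] := @fps_fixpoint n K _ G 2 r r (ltW r0).
- move=> u i u2; apply: ordgeN; apply: ordge_subst => // j; exact: Xu.
- move=> [//|d] u v d2 u2 v2 uv i; rewrite /G -opprD -addn2; apply: ordgeN.
  apply: ordge_substB => // j; [exact: Xu|exact: Xu|].
  by rewrite opprD addrACA subrr add0r.
- move=> u u2 ur i; apply: summableN.
  have Xr j : summable_at (X j + u j) r (2%:R * r).
    rewrite mulr_natl mulr2n; apply: summableD => //; first exact: ltW.
    by have := @summableXm n K r U_(j)%MM (ltW r0); rewrite mdeg1.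
  have rr0 : 0 < 2%:R * r by rewrite mulr_gt0 ?ltr0n.
  apply: summableW (summable_subst _ (ltW r0) (ltW rr0) Xr (cL i _ rr0 rs)) => [|j].
    rewrite (_ : _ * _ = (4%:R * L * r) * r); last by ring.
    by rewrite ler_piMl // ltW.
  exact: Xu.
have wc i : w i \in @convergent n K by apply/convergentP; exists r, r.
by exists (fun i => Cps (wc i)) => [i|i]; [exact: w2 | exact: esym (wE i)].
Qed.

Lemma tangent_left_inverse (c : 'I_n -> cps n K) : (forall i, ordge 2 (c i)) ->
  forall y1 : forall i, ordge 1 (cps_of_mpoly 'X_i + c i)%R,
  exists w : 'I_n -> cps n K, exists w2 : forall i, ordge 2 (w i),
  exists z1 : forall i, ordge 1 (cps_of_mpoly 'X_i + w i)%R,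
  cancel (cps_subst_morphism y1) (cps_subst_morphism z1).
Proof.
move=> c2 y1; have [w w2 wE] := inverse_series c2.
have X1 j : ordge 1 (cps_of_mpoly 'X_j : cps n K) by rewrite -(mdeg1 j); apply: ordgeX.
have z1 i : ordge 1 (cps_of_mpoly 'X_i + w i)%R.
  by apply: (@ordgeD n K 1 (cps_of_mpoly 'X_i) (w i)) => //; apply: (@ordgeW n K 1 2).
exists w, w2, z1 => f.
apply: (lrmorph_ext (phi := cps_subst_morphism z1 \o cps_subst_morphism y1) (psi := idfun)) => i.
apply: cps_inj; set Y := fun j => cps_fps (cps_of_mpoly 'X_j + w j).
change (fps_subst Y (cps_subst_morphism y1 (cps_of_mpoly 'X_i)) = fps_of_mpoly 'X_i).
rewrite cps_subst_mpoly fps_evalXU cpsDE fps_substD // cps_of_mpolyE.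
rewrite fps_subst_mpoly // fps_evalXU /Y cpsDE cps_of_mpolyE -addrA.
by rewrite {1}(wE i) addNr addr0.
Qed.

(** The left inverse is again tangent to the identity, so it has a left inverse of its own and is
    therefore two-sided. *)
Lemma tangent_automorphism (c : 'I_n -> cps n K) : (forall i, ordge 2 (c i)) ->
  exists2 phi : {lrmorphism cps n K -> cps n K}, bijective phi &
    forall p, cps_fps (phi (cps_of_mpoly p)) =
      fps_eval (fun i => fps_of_mpoly 'X_i + (c i : fps n K)) p.
Proof.
move=> c2; have y1 i : ordge 1 (cps_of_mpoly 'X_i + c i).
  apply: (@ordgeD n K 1 (cps_of_mpoly 'X_i) (c i)); last exact: (@ordgeW n K 1 2).
  by rewrite -(mdeg1 i); apply: ordgeX.
have [w [w2 [z1 yz]]] := tangent_left_inverse c2 y1.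
have [v [v2 [t1 zt]]] := tangent_left_inverse w2 z1.
exists (cps_subst_morphism y1); last by move=> p; rewrite cps_subst_mpoly.
exists (cps_subst_morphism z1) => // f.
by rewrite -[LHS]zt yz zt.
Qed.

End Substitution.

(** * Finite determinacy *)

Lemma subr_subl (V : zmodType) (x y z : V) : (x - y) - (x - z) = z - y.
Proof. by rewrite opprB addrC addrA subrK. Qed.

Lemma taylor_step (R : comPzRingType) (x c F A S : R) :
  (x + c) * F - x * A - (c * A + x * S) = x * (F - A - S) + c * (F - A).
Proof. ring. Qed.

Section Determinacy.
Variables (n : nat) (K : numFieldType).
Implicit Types (f g : fps n K) (p q : {mpoly K[n]}) (a b : 'X_{1..n}).
Implicit Types (c u v : 'I_n -> fps n K).

Local Notation Xf i := (fps_of_mpoly 'X_i : fps n K).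
Local Notation shift c := (fun i => Xf i + c i).

Lemma ordgeXf i : ordge 1 (Xf i).
Proof. by rewrite -(mdeg1 i); apply: ordgeX. Qed.

Lemma ordge_shift k c : (forall i, ordge k.+1 (c i)) -> forall i, ordge 1 (Xf i + c i).
Proof.
by move=> ck i; apply: ordgeD; [apply: ordgeXf | apply: ordgeW (ck i)].
Qed.

Lemma mmap1Xf a : mmap1 (fun i => Xf i) a = fps_of_mpoly 'X_[a].
Proof.
elim/mnm_ind: a => [|i a IH]; first by rewrite mmap11 mpolyX0 rmorph1.
by rewrite mmap1S IH mpolyXD rmorphM.
Qed.

(* The part of the Taylor expansion of p(x + c) that is at least quadratic in c. *)
Definition taylor2 p c : fps n K :=
  fps_eval (shift c) p - fps_of_mpoly p - \sum_i c i * fps_of_mpoly p^`M(i).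

Lemma taylor2E p c : taylor2 p c = \sum_(a <- msupp p) p@_a *: taylor2 'X_[a] c.
Proof.
rewrite /taylor2 [in LHS]fps_evalE {1}fps_of_mpolyX -sumrB.
rewrite (eq_bigr (fun i => \sum_(a <- msupp p)
    p@_a *: (c i * fps_of_mpoly ('X_[a])^`M(i)))) => [|i _]; last first.
  rewrite {1}[p]mpolyE (raddf_sum (mderiv i)) (raddf_sum (@fps_of_mpoly n K)) mulr_sumr.
  apply: eq_bigr => a _.
  by rewrite /= mderivZ fps_of_mpoly_scalable scalerAr.
rewrite exchange_big -sumrB; apply: eq_bigr => a _.
by rewrite fps_evalX !scalerBr scaler_sumr.
Qed.

(** This recursion on monomials carries both the order estimate and the norm estimate of the
    remainder, with no second-order Taylor formula. *)
Lemma taylor2XS i a c : taylor2 'X_[U_(i) + a] c =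
  Xf i * taylor2 'X_[a] c + c i * (mmap1 (shift c) a - fps_of_mpoly 'X_[a]).
Proof.
rewrite /taylor2 !fps_evalX mmap1S.
have -> : \sum_j c j * fps_of_mpoly ('X_[U_(i) + a])^`M(j) =
    c i * fps_of_mpoly 'X_[a] + Xf i * \sum_j c j * fps_of_mpoly ('X_[a])^`M(j).
  rewrite mulr_sumr (eq_bigr (fun j => (if j == i then c i * fps_of_mpoly 'X_[a] else 0) +
      Xf i * (c j * fps_of_mpoly ('X_[a])^`M(j)))) => [|j _].
    by rewrite big_split -big_mkcond big_pred1_eq.
  rewrite mpolyXD mderivM rmorphD !rmorphM mulrDr [in X in _ + X]mulrCA; congr (_ + _).
  rewrite mderivX mnm1E eq_sym; case: eqP => [->|_]; last by rewrite scale0r rmorph0 mul0r mulr0.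
  rewrite scale1r (_ : (U_(i) - U_(i))%MM = 0%MM) ?mpolyX0 ?rmorph1 ?mul1r //.
  by apply/mnmP => l; rewrite mnmBE mnm0E subnn.
have -> : fps_of_mpoly 'X_[U_(i) + a] = Xf i * fps_of_mpoly 'X_[a] by rewrite mpolyXD rmorphM.
exact: taylor_step.
Qed.

(** The remainder is quadratic in the shift: one factor has order d + 1, another k + 1, and the
    other |a| - 2 have order at least 1. *)
Lemma ordge_taylor2XB k d u v a :
    (forall i, ordge k.+1 (u i)) -> (forall i, ordge k.+1 (v i)) ->
    (forall i, ordge d.+1 (u i - v i)) ->
  ordge (d + k + mdeg a) (taylor2 'X_[a] u - taylor2 'X_[a] v).
Proof.
move=> uk vk uv; have su := ordge_shift uk; have sv := ordge_shift vk.
elim/mnm_ind: a => [|i a IH].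
  have T0 c : taylor2 'X_[0] c = 0.
    rewrite /taylor2 fps_evalX mmap11 mpolyX0 rmorph1 subrr big1 ?subr0 // => i _.
    by rewrite -mpolyC1 mderivC rmorph0 mulr0.
  by rewrite !T0 subrr.
rewrite !taylor2XS opprD addrACA -mulrBr mulr_subM mdegD mdeg1; apply: ordgeD.
  by rewrite addnCA; apply: ordgeM => //; apply: ordgeXf.
rewrite opprB addrA subrK; apply: ordgeD.
  rewrite (_ : (d + k + _)%N = (d.+1 + (k + mdeg a))%N); last by lia.
  apply: ordgeM => //; rewrite -mmap1Xf; apply: ordge_mmap1B => // [j|j]; first exact: ordgeXf.
  by rewrite addrC addKr.
rewrite (_ : (d + k + _)%N = (k.+1 + (d + mdeg a))%N); last by lia.
apply: ordgeM => //; apply: ordge_mmap1B => // j.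
by rewrite opprD addrACA subrr add0r.
Qed.

Lemma ordge_taylor2B m p k d u v : p \is m.-homog ->
    (forall i, ordge k.+1 (u i)) -> (forall i, ordge k.+1 (v i)) ->
    (forall i, ordge d.+1 (u i - v i)) ->
  ordge (d + k + m) (taylor2 p u - taylor2 p v).
Proof.
move=> pm uk vk uv; rewrite !taylor2E -sumrB big_seq; apply: ordge_sum => a ap.
by rewrite -scalerBr -(dhomog_mf pm ap); apply: ordgeZ; apply: ordge_taylor2XB.
Qed.

Lemma taylor2_0 p : taylor2 p (fun=> 0) = 0.
Proof.
rewrite /taylor2 [X in _ - X]big1 => [|i _]; last by rewrite mul0r.
rewrite subr0 fps_evalE fps_of_mpolyX; apply/eqP; rewrite subr_eq0; apply/eqP.
apply: eq_bigr => a _; rewrite -mmap1Xf; congr (_ *: _); apply: mmap1_eq => i.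
by rewrite addr0.
Qed.

Section Bounds.
Variables (r mu : K).
Hypotheses (r0 : 0 <= r) (mu0 : 0 <= mu) (mu1 : mu <= 1).
Variable c : 'I_n -> fps n K.
Hypothesis cr : forall i, summable_at (c i) r (mu * r).

Lemma summableXf i : summable_at (Xf i) r r.
Proof. by have := @summableXm n K r U_(i)%MM r0; rewrite mdeg1. Qed.

Lemma summable_shift i : summable_at (Xf i + c i) r (2%:R * r).
Proof.
apply: summableW (summableD r0 (summableXf i) (cr i)).
by rewrite mulr_natl mulr2n lerD2l ler_piMl.
Qed.

Lemma summable_mmap1_shiftB a :
  summable_at (mmap1 (shift c) a - fps_of_mpoly 'X_[a]) r (2%:R ^+ mdeg a * mu * r ^+ mdeg a).
Proof.
elim/mnm_ind: a => [|i a IH].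
  by rewrite mmap11 mpolyX0 rmorph1 subrr; apply: summable0; rewrite !mulr_ge0 ?exprn_ge0.
have -> : mmap1 (shift c) (U_(i) + a) - fps_of_mpoly 'X_[U_(i) + a] =
    Xf i * (mmap1 (shift c) a - fps_of_mpoly 'X_[a]) + c i * mmap1 (shift c) a.
  by rewrite mmap1S mpolyXD rmorphM mulrBr mulrDl addrAC.
have Hs := summable_mmap1 a r0 summable_shift.
apply: summableW (summableD r0 (summableM r0 (summableXf i) IH) (summableM r0 (cr i) Hs)).
rewrite mdegD mdeg1 add1n !exprS exprMn le_eqVlt; apply/orP; left; apply/eqP.
move: (2%:R ^+ _) (r ^+ _) => x z; ring.
Qed.

(** Two factors c_i give mu^2. The recursion adds the bound 2^d of the first difference to 4^d, and
    4^d + 2^d <= 4^(d+1). *)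
Lemma summable_taylor2X a :
  summable_at (taylor2 'X_[a] c) r (4%:R ^+ mdeg a * mu ^+ 2 * r ^+ mdeg a).
Proof.
elim/mnm_ind: a => [|i a IH].
  rewrite /taylor2 fps_evalX mmap11 mpolyX0 rmorph1 subrr big1 ?subr0 => [|i _].
    by apply: summable0; rewrite !mulr_ge0 ?exprn_ge0.
  by rewrite -mpolyC1 mderivC rmorph0 mulr0.
rewrite taylor2XS.
apply: summableW (summableD r0 (summableM r0 (summableXf i) IH)
  (summableM r0 (cr i) (summable_mmap1_shiftB a))).
set d := mdeg a; rewrite mdegD mdeg1 add1n -/d.
have le24 : 2%:R ^+ d <= 4%:R ^+ d :> K by apply: lerXn2r; rewrite ?nnegrE ?ler0n ?ler_nat.
apply: (@le_trans _ _ ((4%:R ^+ d + 4%:R ^+ d) * (mu ^+ 2 * r ^+ d.+1))).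
  rewrite [leLHS](_ : _ = (4%:R ^+ d + 2%:R ^+ d) * (mu ^+ 2 * r ^+ d.+1)); last first.
    by rewrite [r ^+ d.+1]exprS; move: (2%:R ^+ _) (4%:R ^+ _) (r ^+ _) => x x' z; ring.
  by rewrite ler_wpM2r ?mulr_ge0 ?exprn_ge0 // lerD2l.
rewrite -mulrA ler_wpM2r ?mulr_ge0 ?exprn_ge0 // [4%:R ^+ d.+1]exprS -mulr2n.
rewrite -[_ ^+ d *+ 2]mulr_natl.
by rewrite ler_wpM2r ?exprn_ge0 ?ler0n ?ler_nat.
Qed.

Lemma summable_taylor2 m p : p \is m.-homog ->
  summable_at (taylor2 p c) r (mnorm p * (4%:R ^+ m * mu ^+ 2) * r ^+ m).
Proof.
move=> pm; rewrite taylor2E -mulrA /mnorm mulr_suml !big_seq; apply: summable_sum => // a ap.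
by apply: summableZ; rewrite -(dhomog_mf pm ap); apply: summable_taylor2X.
Qed.

End Bounds.

Section Solve.
Variables (m k : nat) (p : {mpoly K[n]}).
Hypotheses (k_gt0 : (0 < k)%N) (p_homog : p \is m.-homog).
Variable t : 'X_{1..n} -> 'I_n -> {mpoly K[n]}.
Hypothesis t_homog : forall b i, mdeg b = (k + m)%N -> t b i \is k.+1.-homog.
Hypothesis tE : forall b, mdeg b = (k + m)%N -> 'X_[b] = \sum_i t b i * p^`M(i).

Let L := (k + m)%N.

(** The operator T: the polynomials [t b i] lift the monomials of degree L, and [fps_quo] extends
    the lift to all series of order L. *)
Definition lift_jacobian i (s : fps n K) : fps n K :=
  \sum_(b : 'X_{1..n < L.+1} | mdeg b == L) fps_of_mpoly (t b i) * fps_quo b s.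

Lemma lift_jacobianP s : ordge L s ->
  \sum_i lift_jacobian i s * fps_of_mpoly p^`M(i) = s.
Proof.
move=> sL; rewrite {2}(fps_decomp sL) /lift_jacobian.
under eq_bigr do rewrite mulr_suml.
rewrite exchange_big; apply: eq_bigr => b /eqP bL.
rewrite tE // rmorph_sum mulr_suml; apply: eq_bigr => i _.
by rewrite rmorphM mulrAC.
Qed.

Lemma lift_jacobianB i s s' :
  lift_jacobian i (s - s') = lift_jacobian i s - lift_jacobian i s'.
Proof.
by rewrite -sumrB; apply: eq_bigr => b _; rewrite fps_quoB mulrBr.
Qed.

Lemma ordge_lift_jacobian j i s : ordge (L + j) s -> ordge (k.+1 + j) (lift_jacobian i s).
Proof.
move=> sj; apply: ordge_sum => b /eqP bL; apply: ordgeM; last exact: ordge_quo.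
by apply: ordge_homog; apply: t_homog.
Qed.

Definition lift_norm : K :=
  \sum_i \sum_(b : 'X_{1..n < L.+1} | mdeg b == L) mnorm (t b i).

Lemma lift_norm_ge0 : 0 <= lift_norm.
Proof. by apply: sumr_ge0 => i _; apply: sumr_ge0 => b _; apply: mnorm_ge0. Qed.

(** The powers of r combine to r^(k+1) r^m / r^(k+m) = r: [t b i] has degree k + 1, and division by
    X^b costs r^(k+m). Hence [lift_norm] does not depend on r. *)
Lemma summable_lift_jacobian i s r M : 0 < r -> summable_at s r (M * r ^+ m) ->
  summable_at (lift_jacobian i s) r (lift_norm * M * r).
Proof.
move=> r0 sM; have M0 : 0 <= M.
  by have := summable_ge0 sM; rewrite pmulr_lge0 ?exprn_gt0.
apply: (@summableW _ _ _ _ (\sum_(b : 'X_{1..n < L.+1} | mdeg b == L) mnorm (t b i) * (M * r))).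
  rewrite -mulr_suml -mulrA ler_wpM2r ?mulr_ge0 ?(ltW r0) // /lift_norm (bigD1 i) //= lerDl.
  by apply: sumr_ge0 => j _; apply: sumr_ge0 => b _; apply: mnorm_ge0.
apply: summable_sum => [|b /eqP bL]; first exact: ltW.
have H := summableM (ltW r0) (summable_homog (ltW r0) (t_homog i bL)) (summable_quo r0 bL sM).
apply: summableW H; rewrite /L exprD exprS le_eqVlt; apply/orP; left; apply/eqP.
by field; rewrite !expf_neq0 ?gt_eqF.
Qed.

Lemma small_radius (s x z : K) : 0 < s -> 0 <= x -> 0 <= z ->
  exists r, [/\ 0 < r, r <= 1, r <= s, x * r <= 1 & z * r <= 1].
Proof.
move=> s0 x0 z0; pose D := 1 + s^-1 + x + z.
have si0 : 0 <= s^-1 by rewrite invr_ge0 ltW.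
have D0 : 0 < D by rewrite /D -!addrA ltr_wpDr ?addr_ge0.
have le1 y : y <= D -> y * D^-1 <= 1 by move=> yD; rewrite ler_pdivrMr // mul1r.
exists D^-1; split; rewrite ?invr_gt0 //.
- by rewrite -[D^-1]mul1r le1 // /D -!addrA lerDl ?addr_ge0.
- rewrite -[s]mulr1 -ler_pdivrMl // le1 //.
  by rewrite /D -!addrA addrCA lerDl ?addr_ge0.
- by rewrite le1 // /D addrAC lerDr ?addr_ge0.
by rewrite le1 // /D lerDr ?addr_ge0.
Qed.

Lemma solve_jacobian (h : cps n K) : ordge L h ->
  exists2 c : 'I_n -> cps n K, forall i, ordge 2 (c i) &
    fps_eval (fun i => Xf i + (c i : fps n K)) p = fps_of_mpoly p + h.
Proof.
move=> hL; have [s s0 [A A0 hA]] := cps_small hL.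
pose B := lift_norm; have B0 : 0 <= B := lift_norm_ge0.
(* The iterates are kept below C r^2, that is mu = C r. T(h) contributes at most B A r^2, because k
   > 0 and r <= 1, and T(Q) at most E r^3 <= r^2; the two add up to C r^2. *)
pose C := B * A + 1; have C0 : 0 <= C by rewrite addr_ge0 ?mulr_ge0.
pose E := B * (mnorm p * 4%:R ^+ m) * C ^+ 2.
have E0 : 0 <= E by rewrite !mulr_ge0 ?exprn_ge0 ?mnorm_ge0 ?ler0n.
have [r [r0 r1 rs Cr Er]] := small_radius s0 C0 E0.
pose G u i := lift_jacobian i ((h : fps n K) - taylor2 p u).
(* Since Q(0) = 0, comparing u with 0 gives Q(u) the order k + k + m >= L, so T applies to h -
   Q(u). *)
have TL u : (forall i, ordge k.+1 (u i)) -> ordge L ((h : fps n K) - taylor2 p u).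
  move=> uk; apply: ordgeB => //; rewrite -[taylor2 p u]subr0 -(taylor2_0 p).
  have := @ordge_taylor2B m p k k u (fun=> 0) p_homog uk.
  by move=> /(_ _ _)/ordgeW; apply=> // [|i]; [rewrite /L -addnA leq_addl | rewrite subr0].
have [||||c [ck cE cr]] := @fps_fixpoint n K _ G k.+1 r (C * r * r).
- by rewrite !mulr_ge0 // ltW.
- move=> u i uk; rewrite -[k.+1]addn0; apply: ordge_lift_jacobian.
  by rewrite addn0; apply: TL.
- move=> [//|d] u v kd uk vk uv i; rewrite /G -lift_jacobianB subr_subl.
  have Td : ordge (L + d) (taylor2 p v - taylor2 p u).
    rewrite addnC addnA.
    by apply: ordge_taylor2B => // j; rewrite -opprB; apply: ordgeN.
  (* Here k > 0 is decisive: from shifts that agree up to order d + 1, T returns agreement up to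
     order k + 1 + d >= d + 2. *)
  have le_d : (d.+2 <= k.+1 + d)%N by rewrite addSn ltnS -add1n leq_add2r.
  exact: (ordgeW le_d (ordge_lift_jacobian i Td)).
- move=> u uk ur i.
  have ht : summable_at (h : fps n K) r (A * r ^+ k * r ^+ m).
    by rewrite -mulrA -exprD; apply: hA.
  have Cr0 : 0 <= C * r by rewrite mulr_ge0 // ltW.
  have ut := summable_taylor2 (ltW r0) Cr0 Cr ur p_homog.
  have := summableB (ltW r0) ht ut; rewrite -mulrDl => /(summable_lift_jacobian i r0).
  apply: summableW; rewrite ler_wpM2r ?(ltW r0) // -/B mulrDr.
  rewrite [leRHS](_ : _ = B * A * r + r); last by rewrite /C mulrDl mul1r.
  apply: lerD.
    rewrite mulrA ler_wpM2l ?mulr_ge0 // -(prednK k_gt0) exprS ler_piMr ?(ltW r0) //.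
    by rewrite exprn_ile1 // ltW.
  rewrite (_ : B * _ = E * r * r); last first.
    rewrite /E; move: (C) (4%:R ^+ m) (mnorm p) => C' x P; ring.
  by rewrite ler_piMl // ltW.
have cc i : c i \in @convergent n K by apply/convergentP; exists r, (C * r * r).
exists (fun i => Cps (cc i)) => [i|]; first exact: ordgeW (ck i).
have := lift_jacobianP (TL c ck).
under eq_bigr do rewrite -/(G c _) cE.
move=> E1; have /esym/eqP : taylor2 p c =
    fps_eval (shift c) p - fps_of_mpoly p - ((h : fps n K) - taylor2 p c).
  by rewrite {1}/taylor2 E1.
by rewrite subr_eq [X in _ == X]addrC subrK subr_eq [X in _ == X]addrC => /eqP.
Qed.

Lemma jacobian_determined (g : cps n K) : ordge L (g - cps_of_mpoly p)%R ->
  right_equiv (cps_of_mpoly p) g.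
Proof.
move=> /solve_jacobian[c c2 cE]; have [phi phi_bij phiE] := tangent_automorphism c2.
exists phi => //; apply: cps_inj.
by rewrite phiE cE cpsBE cps_of_mpolyE addrC subrK.
Qed.

End Solve.

End Determinacy.

(** * Nullstellensatz *)

Definition is_ideal (A : comNzRingType) (I : A -> Prop) : Prop :=
  [/\ I 0, forall x y, I x -> I y -> I (x + y) & forall a x, I x -> I (a * x)].

Section IdealTheory.
Variables (A : comNzRingType) (I : A -> Prop).
Hypothesis idI : is_ideal I.

Lemma ideal0 : I 0. Proof. by case: idI. Qed.
Lemma idealD x y : I x -> I y -> I (x + y). Proof. by case: idI => _ D _; apply: D. Qed.
Lemma idealMl a x : I x -> I (a * x). Proof. by case: idI => _ _; apply. Qed.
Lemma idealMr a x : I x -> I (x * a). Proof. by rewrite mulrC; apply: idealMl. Qed.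
Lemma idealN x : I x -> I (- x). Proof. by rewrite -mulN1r; apply: idealMl. Qed.
Lemma idealB x y : I x -> I y -> I (x - y).
Proof. by move=> Ix /idealN; apply: idealD. Qed.
Lemma ideal_sum (T : Type) (s : seq T) (P : pred T) (F : T -> A) :
  (forall i, P i -> I (F i)) -> I (\sum_(i <- s | P i) F i).
Proof. by move=> IF; elim/big_ind: _ => //; [apply: ideal0 | apply: idealD]. Qed.

Lemma ideal_adjoin z : is_ideal (fun x => exists a b, I a /\ x = a + b * z).
Proof.
split=> [|x y [a [b [Ia ->]]] [a' [b' [Ia' ->]]]|c x [a [b [Ia ->]]]].
- by exists 0, 0; rewrite mul0r addr0; split=> //; apply: ideal0.
- by exists (a + a'), (b + b'); rewrite mulrDl addrACA; split=> //; apply: idealD.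
by exists (c * a), (c * b); rewrite mulrDr mulrA; split=> //; apply: idealMl.
Qed.

End IdealTheory.

Section GradedIdeals.
Variables (n : nat) (K : comNzRingType).
Local Notation S := {mpoly K[n]}.

Lemma pihomogMr (p q : S) d e : q \is e.-homog ->
  pihomog mdeg (d + e) (p * q) = pihomog mdeg d p * q.
Proof.
move=> qe; rewrite {1}[p](pihomog_partitionE (leqnn (msize p))) mulr_suml raddf_sum /=.
have H (j : nat) : pihomog mdeg (d + e) (pihomog mdeg j p * q) =
    if j == d then pihomog mdeg d p * q else 0.
  have jh : pihomog mdeg j p * q \is (j + e).-homog by apply: dhomogM => //; apply: pihomogP.
  case: eqVneq => [<-|jd]; first by rewrite pihomog_dE.
  by rewrite (pihomog_ne0 _ jh) // eqn_add2r.
under eq_bigr do rewrite H.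
have [dp|pd] := ltnP d (msize p).
  by rewrite (bigD1 (Ordinal dp)) //= eqxx big1 ?addr0 // => j /negbTE; rewrite -val_eqE /= => ->.
rewrite big1 => [|j _]; last by rewrite ltn_eqF // (leq_trans (ltn_ord j)).
suff -> : pihomog mdeg d p = 0 by rewrite mul0r.
rewrite pihomogE big_seq_cond big1 // => a /andP[/msize_mdeg_lt ap /eqP ad].
by move: ap; rewrite ad ltnNge pd.
Qed.

Lemma pihomogMr_lt (p q : S) d e : q \is e.-homog -> (d < e)%N ->
  pihomog mdeg d (p * q) = 0.
Proof.
move=> qe de; rewrite {1}[p](pihomog_partitionE (leqnn (msize p))) mulr_suml raddf_sum /=.
rewrite big1 // => j _.
have jh : pihomog mdeg j p * q \is (j + e).-homog by apply: dhomogM => //; apply: pihomogP.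
by rewrite (pihomog_ne0 _ jh) // neq_ltn (leq_trans de) ?leq_addl ?orbT.
Qed.

Variables (e : nat) (F : 'I_n -> S).
Hypothesis F_homog : forall i, F i \is e.-homog.

Definition gen_ideal (s : S) : Prop := exists b : 'I_n -> S, s = \sum_i b i * F i.

Lemma gen_idealP : is_ideal gen_ideal.
Proof.
split=> [|x y [b ->] [b' ->]|a x [b ->]].
- by exists (fun=> 0); rewrite big1 // => i _; rewrite mul0r.
- by exists (fun i => b i + b' i); rewrite -big_split; apply: eq_bigr => i _; rewrite mulrDl.
by exists (fun i => a * b i); rewrite mulr_sumr; apply: eq_bigr => i _; rewrite mulrA.
Qed.

Lemma gen_ideal_gen i : gen_ideal (F i).
Proof.
exists (fun j => (j == i)%:R); rewrite (bigD1 i) //= eqxx mul1r big1 ?addr0 // => j.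
by move=> /negbTE ->; rewrite mul0r.
Qed.

Lemma gen_ideal_pihomog d s : gen_ideal s -> gen_ideal (pihomog mdeg d s).
Proof.
case=> b ->; rewrite raddf_sum; apply: (ideal_sum gen_idealP) => i _ /=.
have [ed|de] := leqP e d; last first.
  by rewrite (pihomogMr_lt _ (F_homog i)) //; apply: ideal0 gen_idealP.
rewrite -(subnK ed) (pihomogMr _ _ (F_homog i)).
exact: (idealMl gen_idealP) (gen_ideal_gen i).
Qed.

(** Each coefficient is replaced by its component of degree d - e. *)
Lemma gen_ideal_homog d s : s \is d.-homog -> (e <= d)%N -> gen_ideal s ->
  exists b : 'I_n -> S, (forall i, b i \is (d - e).-homog) /\ s = \sum_i b i * F i.
Proof.
move=> sd ed [b sE]; exists (fun i => pihomog mdeg (d - e) (b i)).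
split=> [i|]; first exact: pihomogP.
rewrite -(pihomog_dE sd) sE raddf_sum; apply: eq_bigr => i _ /=.
by rewrite -{1}(subnK ed) (pihomogMr _ _ (F_homog i)).
Qed.

End GradedIdeals.

Section Nullstellensatz.
Variables (n : nat) (K : closedFieldType).
(** Uncountability in the form used below: some sublevel set of F is infinite, as otherwise K would
    be a countable union of finite sets. *)
Hypothesis uncountable_K : forall F : K -> nat, exists d, forall N,
  exists s : seq K, [/\ uniq s, size s = N & all (fun c => (F c <= d)%N) s].

Local Notation S := {mpoly K[n]}.

Section Step.
Variables (I : S -> Prop) (i : 'I_n).
Hypotheses (idI : is_ideal I)
  (invI : forall c, exists b : S, I (1 - b * ('X_i - c%:MP))).

Lemma ideal_cancel c u : I (u * ('X_i - c%:MP)) -> I u.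
Proof.
move=> Iu; have [b Ib] := invI c.
have -> : u = u * (1 - b * ('X_i - c%:MP)) + b * (u * ('X_i - c%:MP)).
  by rewrite mulrBr mulr1 mulrCA subrK.
by apply: idealD => //; apply: idealMl.
Qed.

Lemma ideal_poly_unit (q : {poly K}) : q != 0 -> I (horner_alg ('X_i : S) q) -> I 1.
Proof.
move=> q0; have [r ->] := closed_field_poly_normal q; rewrite linearZ /= => Iq.
have {Iq} : I (horner_alg ('X_i : S) (\prod_(z <- r) ('X - z%:P))).
  have := idealMl idI (lead_coef q)^-1%:MP Iq.
  by rewrite mul_mpolyC mulr_algl scalerA mulVf ?lead_coef_eq0 // scale1r.
elim: r => [|z r IH]; first by rewrite big_nil rmorph1.
rewrite big_cons rmorphM mulrC rmorphB /= horner_algX horner_algC alg_mpolyC.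
by move=> /ideal_cancel.
Qed.

(** Infinitely many of the inverses b_c of X_i - c have degree below a common d, so D + 1 of them,
    in a space of dimension D, are linearly dependent. Multiplying the dependency by the product of
    the X_i - a_k produces a nonzero polynomial in X_i that lies in I. *)
Lemma ideal_improper : I 1.
Proof.
have /choice[b bP] := invI; have [d dP] := uncountable_K (fun c => msize (b c)).
pose D := #|{: 'X_{1..n < d}}|; have [s [us sz sd]] := dP D.+1.
pose a (k : 'I_D.+1) := s`_k.
have ad k : (msize (b (a k)) <= d)%N by apply: (allP sd); rewrite mem_nth ?sz.
have a_inj k l : a k = a l -> k = l.
  by move=> /eqP; rewrite nth_uniq ?sz // => /eqP/val_inj.
pose M := \matrix_(k < D.+1, j < D) (b (a k))@_(enum_val j : 'X_{1..n < d}).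
have /rowV0Pn[v /sub_kermxP vM v0] : kermx M != 0.
  by rewrite kermx_eq0 /row_free neq_ltn (leq_ltn_trans (rank_leq_col M)).
have [k0 vk0] : exists k, v 0 k != 0.
  apply/existsP; apply: contraNT v0; rewrite negb_exists => /forallP vk.
  by apply/eqP/rowP => k; rewrite mxE; apply/eqP; have := vk k; rewrite negbK.
have vb : \sum_k v 0 k *: b (a k) = 0.
  apply/mpolyP => c; rewrite mcoeff0 raddf_sum /=.
  have [cd|dc] := ltnP (mdeg c) d; last first.
    rewrite big1 // => k _; rewrite mcoeffZ memN_msupp_eq0 ?mulr0 //.
    by apply: msize_mdeg_ge; apply: leq_trans dc.
  have /matrixP/(_ 0 (enum_rank (BMultinom cd))) := vM; rewrite !mxE => E.
  by rewrite -[RHS]E; apply: eq_bigr => k _; rewrite mxE enum_rankK mcoeffZ.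
pose P k := \prod_(j | j != k) ('X - (a j)%:P) : {poly K}.
pose ev := horner_alg ('X_i : S).
apply: (@ideal_poly_unit (\sum_k v 0 k *: P k)).
  apply: contraNneq vk0 => Q0; have := congr1 (horner^~ (a k0)) Q0.
  rewrite horner0 horner_sum (bigD1 k0) //= big1 => [|k kk0].
    rewrite addr0 hornerZ => /eqP; rewrite mulf_eq0 => /orP[//|].
    rewrite horner_prod prodf_seq_eq0 => /hasP[j _ /andP[jk0]].
    by rewrite hornerXsubC subr_eq0 => /eqP/a_inj E; rewrite E eqxx in jk0.
  by rewrite hornerZ horner_prod (bigD1 k0) 1?eq_sym //= hornerXsubC subrr mul0r mulr0.
have evP k : ev (P k) * ('X_i - (a k)%:MP) = ev (\prod_j ('X - (a j)%:P)).
  have -> : \prod_j ('X - (a j)%:P) = P k * ('X - (a k)%:P) :> {poly K}.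
    by rewrite mulrC (bigD1 k).
  by rewrite /ev rmorphM rmorphB /= horner_algX horner_algC alg_mpolyC.
have -> : horner_alg ('X_i : S) (\sum_k v 0 k *: P k) =
    \sum_k v 0 k *: (ev (P k) * (1 - b (a k) * ('X_i - (a k)%:MP))).
  rewrite (eq_bigr (fun k => v 0 k *: ev (P k) -
     (v 0 k *: b (a k)) * ev (\prod_j ('X - (a j)%:P)))) => [|k _]; last first.
    by rewrite mulrBr mulr1 mulrCA evP scalerBr scalerAl.
  rewrite sumrB -mulr_suml vb mul0r subr0 linear_sum; apply: eq_bigr => k _.
  by rewrite linearZ /= mulr_algl.
by apply: ideal_sum => // k _; rewrite -mul_mpolyC; do 2 apply: idealMl => //.
Qed.

End Step.

(** The X_i - c_i are adjoined one variable at a time, keeping the ideal proper: [ideal_improper]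
    provides a c_i for which X_i - c_i is not invertible. In the end s is congruent to s(c). *)
Lemma nullstellensatz (I : S -> Prop) : is_ideal I -> ~ I 1 ->
  exists c : 'I_n -> K, forall s, I s -> s.@[c] = 0.
Proof.
move=> idI I1.
have : forall k, (k <= n)%N -> exists (c : 'I_n -> K) (I' : S -> Prop),
  [/\ is_ideal I', ~ I' 1, forall s, I s -> I' s &
      forall i : 'I_n, (i < k)%N -> I' ('X_i - (c i)%:MP)].
  elim=> [|k IH] kn; first by exists (fun=> 0), I; split.
  have [c [I' [idI' I'1 II' I'c]]] := IH (ltnW kn).
  pose i0 := Ordinal kn.
  have [x xP] : exists x, ~ exists b, I' (1 - b * ('X_i0 - x%:MP)).
    by apply: contrapT => /forallNP H; apply: I'1; apply: (@ideal_improper I' i0) => // x;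
       apply: contrapT; apply: H.
  exists (fun i => if i == i0 then x else c i).
  exists (fun s => exists a b, I' a /\ s = a + b * ('X_i0 - x%:MP)).
  split; first exact: ideal_adjoin.
  - by move=> [a [b [I'a E]]]; apply: xP; exists b; rewrite E addrK.
  - by move=> s /II' I's; exists s, 0; rewrite mul0r addr0.
  move=> i ik; have [->|ii0] := eqVneq i i0.
    by exists 0, 1; rewrite add0r mul1r; split=> //; apply: (ideal0 idI').
  exists ('X_i - (c i)%:MP), 0; rewrite mul0r addr0; split=> //; apply: I'c.
  by move: ik; rewrite ltnS leq_eqVlt => /predU1P[ik|//]; case/eqP: ii0; apply: val_inj.
move=> /(_ n (leqnn n))[c [I' [idI' I'1 II' I'c]]]; exists c => s /II' I's.
have X a : I' ('X_[a] - ('X_[a]).@[c]%:MP).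
  elim/mnm_ind: a => [|i a IH].
    by rewrite mpolyX0 rmorph1 mpolyC1 subrr; apply: (ideal0 idI').
  rewrite mpolyXD rmorphM mpolyCM mulr_subM /= mevalXU.
  apply: idealD => //; [apply: idealMr => //; exact: I'c | exact: idealMl].
have Is : I' (s - s.@[c]%:MP).
  rewrite {2}[s]mpolyE {1}[s]mpolyE (raddf_sum (meval c)) (raddf_sum (@mpolyC n K)) -sumrB.
  apply: ideal_sum => // a _; rewrite /= mevalZ mpolyCM mul_mpolyC -scalerBr -mul_mpolyC.
  exact: idealMl.
apply/eqP; apply: contraT => sc0; case: I'1.
have := idealMl idI' (s.@[c])^-1%:MP (idealB idI' I's Is).
by rewrite opprB addrCA subrr addr0 -mpolyCM mulVf.
Qed.

Section PowersInIdeal.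
Variables (e : nat) (F : 'I_n -> S).
Hypothesis F_homog : forall i, F i \is e.-homog.
Hypothesis F_zeros : forall c : 'I_n -> K, (forall i, (F i).@[c] = 0) -> forall i, c i = 0.

(** The zeros of J lie at the origin, where X_j - 1 does not vanish, so some 1 + b - b X_j lies in
    J. Its homogeneous components give b_d + X_j^d in J by induction on d, and b_d = 0 for large
    d. *)
Lemma power_in_gen_ideal j : exists k, gen_ideal F ('X_j ^+ k).
Proof.
have idJ := gen_idealP F.
pose I s := exists a b, gen_ideal F a /\ s = a + b * ('X_j - 1).
have idI : is_ideal I by apply: ideal_adjoin.
have [[a [b [Ja E]]]|I1] := pselect (I 1); last first.
  have [c cP] := nullstellensatz idI I1.
  have c0 : forall i, c i = 0.
    apply: F_zeros => i; apply: cP; exists (F i), 0; rewrite mul0r addr0.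
    by split=> //; apply: gen_ideal_gen.
  have : ('X_j - 1 : S).@[c] = 0.
    by apply: cP; exists 0, 1; rewrite add0r mul1r; split=> //; apply: (ideal0 idJ).
  move/eqP; rewrite mevalB mevalXU meval1 c0 sub0r oppr_eq0 oner_eq0.
  by [].
have X1 : 'X_j \is [in K[n], 1.-homog] by rewrite dhomogX; apply/eqP/mdeg1.
have {E} aE : a = 1 + b - b * 'X_j.
  by rewrite -[a](addrK (b * ('X_j - 1))) -E mulrBr mulr1 opprB addrA.
have bP d : gen_ideal F (pihomog mdeg d b + 'X_j ^+ d).
  elim: d => [|d IH].
    have := gen_ideal_pihomog F_homog 0 Ja; rewrite aE raddfB raddfD /=.
    by rewrite (pihomogMr_lt _ X1) // subr0 pihomog_dE ?dhomog1 // addrC expr0.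
  have := gen_ideal_pihomog F_homog d.+1 Ja; rewrite aE raddfB raddfD /=.
  rewrite -[in X in _ - X]addn1 (pihomogMr _ _ X1).
  have -> : pihomog mdeg d.+1 (1 : S) = 0.
    by apply: (pihomog_ne0 _ (dhomog1 _ _)).
  rewrite add0r => H.
  have := idealD idJ H (idealMr idJ 'X_j IH).
  by rewrite mulrDl -exprSr addrA subrK.
exists (msize b); have := bP (msize b); suff -> : pihomog mdeg (msize b) b = 0 by rewrite add0r.
rewrite pihomogE big_seq_cond big1 // => c /andP[/msize_mdeg_lt cb /eqP cd].
by move: cb; rewrite cd ltnn.
Qed.

End PowersInIdeal.

End Nullstellensatz.

(** * Socle degree of a homogeneous complete intersection *)

Section DetModIdeal.
Variables (A : comNzRingType) (n : nat).
Implicit Types (M N : 'M[A]_n) (u v w : 'rV[A]_n) (i j : 'I_n).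

Definition setrow i w M : 'M[A]_n := \matrix_(k, l) if k == i then w 0 l else M k l.

Lemma row_setrow i w M : row i (setrow i w M) = w.
Proof. by apply/rowP => l; rewrite !mxE eqxx. Qed.

Lemma row'_setrow i u v M : row' i (setrow i u M) = row' i (setrow i v M).
Proof. by apply/matrixP => k l; rewrite !mxE eq_sym (negbTE (neq_lift _ _)). Qed.

Lemma setrow_id i M : setrow i (row i M) M = M.
Proof. by apply/matrixP => k l; rewrite !mxE; case: eqP => // ->. Qed.

Lemma setrowC i j u v M : i != j ->
  setrow i u (setrow j v M) = setrow j v (setrow i u M).
Proof.
move=> ij; apply/matrixP => k l; rewrite !mxE; case: eqP => // ->.
by rewrite (negbTE ij).
Qed.

Lemma det_setrowD i a b u v M : \det (setrow i (a *: u + b *: v) M) =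
  a * \det (setrow i u M) + b * \det (setrow i v M).
Proof.
by apply: (@determinant_multilinear _ _ _ _ _ i); rewrite ?row_setrow //; apply: row'_setrow.
Qed.

Lemma det_setrow_sum i (T : Type) (s : seq T) (a : T -> A) (u : T -> 'rV[A]_n) M :
  \det (setrow i (\sum_(t <- s) a t *: u t) M) = \sum_(t <- s) a t * \det (setrow i (u t) M).
Proof.
elim: s => [|t s IH]; last by rewrite !big_cons -[X in _ + X]scale1r det_setrowD IH mul1r.
rewrite !big_nil -[X in setrow i X](scale0r (0 : 'rV_n)) -[X in setrow i X]addr0.
by rewrite -{2}(scale0r (0 : 'rV_n)) det_setrowD !mul0r addr0.
Qed.

Lemma det_setrow_alt i j w M : i != j -> \det (setrow i w (setrow j w M)) = 0.
Proof.
move=> ij; apply: (determinant_alternate ij) => l.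
by rewrite !mxE eqxx eq_sym (negbTE ij) eqxx.
Qed.

Lemma det_setrow_row i l M : i != l -> \det (setrow i (row l M) M) = 0.
Proof.
move=> il; rewrite -{2}(setrow_id l M); exact: det_setrow_alt.
Qed.

Lemma det_setrow_swap i j u v M : i != j ->
  \det (setrow i u (setrow j v M)) = - \det (setrow i v (setrow j u M)).
Proof.
move=> ij; have := det_setrow_alt (u + v) M ij.
rewrite -{1 2}[u]scale1r -{1 2}[v]scale1r det_setrowD !mul1r.
rewrite ![setrow i _ (setrow j _ _)]setrowC // !det_setrowD !mul1r.
rewrite ![setrow j _ (setrow i _ _)]setrowC 1?eq_sym // !det_setrow_alt // add0r addr0.
by move=> /eqP; rewrite addr_eq0 => /eqP ->.
Qed.

Variable I : A -> Prop.
Hypothesis idI : is_ideal I.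

Lemma det_setrow_ideal i w M : (forall l, I (w 0 l)) -> I (\det (setrow i w M)).
Proof.
move=> Iw; rewrite (expand_det_row _ i); apply: (ideal_sum idI) => l _.
by rewrite mxE eqxx; apply: (idealMr idI).
Qed.

Lemma det_congr M N : (forall i j, I (M i j - N i j)) -> I (\det M - \det N).
Proof.
move=> MN; rewrite -sumrB; apply: (ideal_sum idI) => s _.
rewrite -mulrBr; apply: (idealMl idI).
suff H (f : 'I_n -> 'I_n) (r : seq 'I_n) :
  I (\prod_(i <- r) M i (f i) - \prod_(i <- r) N i (f i)) by exact: H.
elim: r => [|i r IH]; first by rewrite !big_nil subrr; apply: (ideal0 idI).
rewrite !big_cons mulr_subM; apply: (idealD idI).
  exact: (idealMr idI).
exact: (idealMl idI).
Qed.

(* The difference is the determinant of M with row i replaced by w and row j by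
   z M, hence an element of I. *)
Lemma det_koszul (z : 'rV[A]_n) w i j M : i != j -> (forall l, I ((z *m M) 0 l)) ->
  I (\det (\matrix_(k, l) (M k l + ((k == i)%:R * z 0 j - (k == j)%:R * z 0 i) * w 0 l)) - \det M).
Proof.
move=> ij zM; set M' := \matrix_(_, _) _.
have -> : M' = setrow i (1 *: row i M + z 0 j *: w) (setrow j (1 *: row j M + (- z 0 i) *: w) M).
  apply/matrixP => k l; rewrite !mxE; case: (eqVneq k i) => [->|ki].
    by rewrite (negbTE ij) mul1r mul0r subr0 mul1r.
  case: (eqVneq k j) => [->|kj]; first by rewrite !mul1r mul0r sub0r.
  by rewrite !mul0r subr0 mul0r addr0.
set Y := 1 *: row j M + _; rewrite det_setrowD mul1r.
have -> : \det (setrow i (row i M) (setrow j Y M)) = \det M - z 0 i * \det (setrow j w M).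
  by rewrite setrowC // det_setrowD mul1r mulNr !setrow_id.
have -> : \det (setrow i w (setrow j Y M)) = \det (setrow i w M).
  rewrite setrowC // det_setrowD mul1r -[setrow j w _]setrowC // det_setrow_alt //.
  by rewrite mulr0 addr0 -setrowC // setrow_id.
rewrite addrC -addrA addKr addrC.
have E : \det (setrow j (z *m M) (setrow i w M)) =
    z 0 j * \det (setrow i w M) - z 0 i * \det (setrow j w M).
  have -> : z *m M = \sum_l z 0 l *: row l M.
    by apply/rowP => l; rewrite !mxE summxE; apply: eq_bigr => k _; rewrite !mxE.
  rewrite det_setrow_sum (bigD1 j) //= (bigD1 i) //= big1 => [|l /andP[lj li]].
    rewrite addr0 -setrowC // setrow_id; congr (_ + _).
    rewrite -mulrN det_setrow_swap 1?eq_sym // setrowC 1?eq_sym //.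
    by rewrite -[in RHS](setrow_id i M) setrowC.
  rewrite (_ : row l M = row l (setrow i w M)) ?det_setrow_row ?mulr0 1?eq_sym //.
  by apply/rowP => k; rewrite !mxE (negbTE li).
by rewrite -E; apply: det_setrow_ideal.
Qed.

(** [det_koszul] can be iterated because z annihilates each correction, by z_i z_j - z_j z_i = 0, so
    the hypothesis on z M persists. *)
Lemma det_koszul_sum (z : 'rV[A]_n) (w : 'I_n * 'I_n -> 'rV[A]_n) (s : seq ('I_n * 'I_n)) M :
    (forall p, p \in s -> p.1 != p.2) -> (forall l, I ((z *m M) 0 l)) ->
  I (\det (\matrix_(k, l) (M k l +
      \sum_(p <- s) ((k == p.1)%:R * z 0 p.2 - (k == p.2)%:R * z 0 p.1) * w p 0 l)) - \det M).
Proof.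
move=> + zM; elim: s => [|p s IH] sP.
  rewrite (_ : \matrix_(k, l) _ = M) ?subrr; first exact: (ideal0 idI).
  by apply/matrixP => k l; rewrite mxE big_nil addr0.
set N := \matrix_(k, l) (M k l +
  \sum_(q <- s) ((k == q.1)%:R * z 0 q.2 - (k == q.2)%:R * z 0 q.1) * w q 0 l) in IH.
have zN l : I ((z *m N) 0 l).
  rewrite (_ : (z *m N) 0 l = (z *m M) 0 l) // !mxE.
  transitivity (\sum_k (z 0 k * M k l + \sum_(q <- s)
     (z 0 k * ((k == q.1)%:R * z 0 q.2 - (k == q.2)%:R * z 0 q.1)) * w q 0 l)).
    apply: eq_bigr => k _.
    by rewrite mxE mulrDr mulr_sumr; congr (_ + _); apply: eq_bigr => q _; rewrite mulrA.
  rewrite big_split exchange_big /= [X in _ + X]big1 ?addr0 // => q _.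
  rewrite -mulr_suml (_ : \sum_k _ = 0) ?mul0r //.
  under eq_bigr do rewrite mulrBr ![z 0 _ * (_ * _)]mulrCA.
  rewrite sumrB (bigD1 q.1) //= big1 => [|k /negbTE ->]; last by rewrite mul0r.
  rewrite (bigD1 q.2) //= big1 => [|k /negbTE ->]; last by rewrite mul0r.
  by rewrite !eqxx !mul1r !addr0 mulrC subrr.
have := idealD idI (det_koszul (w p) (sP p (mem_head _ _)) zN)
  (IH (fun q qs => sP q (mem_behead (s := p :: s) qs))).
rewrite addrA subrK; congr (I (\det _ - _)).
by apply/matrixP => k l; rewrite !mxE big_cons -addrA [X in _ + X]addrC.
Qed.

End DetModIdeal.

Lemma divided_difference_mul (R : comPzRingType) (z a b c d u t : R) :
  a - b = z * u -> c - d = z * t -> a * c - b * d = z * (u * c + b * t).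
Proof. by move=> ab cd; rewrite mulr_subM ab cd mulrDr !mulrA [b * z]mulrC. Qed.

Definition ord_pairs n : seq ('I_n * 'I_n) :=
  [seq p : 'I_n * 'I_n <- enum {: 'I_n * 'I_n} | (p.1 < p.2)%N].

Lemma sum_koszul (R : comPzRingType) n (z : 'I_n -> R) (w : 'I_n * 'I_n -> R) (l : 'I_n) :
  \sum_(p <- ord_pairs n)
      ((l == p.1)%:R * z p.2 - (l == p.2)%:R * z p.1) * w p =
  \sum_(j : 'I_n | (l < j)%N) z j * w (l, j) - \sum_(i : 'I_n | (i < l)%N) z i * w (i, l).
Proof.
rewrite big_filter big_enum_cond /=.
transitivity (\sum_(i : 'I_n) (\sum_(j : 'I_n | (i < j)%N) (l == i)%:R * (z j * w (i, j)) -
    \sum_(j : 'I_n | (i < j)%N) (l == j)%:R * (z i * w (i, j)))).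
  rewrite [RHS](eq_bigr (fun i : 'I_n => \sum_(j : 'I_n | (i < j)%N)
    ((l == i)%:R * z j - (l == j)%:R * z i) * w (i, j))) => [|i _]; last first.
    by rewrite -sumrB; apply: eq_bigr => j _; rewrite mulrBl !mulrA.
  by rewrite pair_big_dep; apply: eq_big => [[i j]|[i j]].
rewrite sumrB; congr (_ - _).
  rewrite (bigD1 l) //= [X in _ + X]big1 => [|i il].
    by rewrite addr0; apply: eq_bigr => j _; rewrite eqxx mul1r.
  by rewrite big1 // => j _; rewrite eq_sym (negbTE il) mul0r.
rewrite [RHS]big_mkcond; apply: eq_bigr => i _; rewrite big_mkcond (bigD1 l) //= eqxx mul1r.
rewrite big1 ?addr0 // => j jl; case: ifP => // _.
by rewrite eq_sym (negbTE jl) mul0r.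
Qed.

(** * Divided differences and the Bezoutian *)

Section Telescope.
Variables (V : comNzRingType) (n : nat) (z t : 'I_n -> V) (f : nat -> V).
Hypothesis fE : forall l : 'I_n, f l - f l.+1 = z l * t l.

Lemma telescope_low l : (l <= n)%N ->
  f l = f 0%N - \sum_(i : 'I_n | (i < l)%N) z i * t i.
Proof.
elim: l => [|l IH] ln; first by rewrite big_pred0 ?subr0.
rewrite (bigD1 (Ordinal ln)) //= (eq_bigl (fun i : 'I_n => (i < l)%N)) => [|i]; last first.
  by rewrite ltnS -val_eqE /= ltn_neqAle andbC.
by rewrite opprD addrCA -IH 1?ltnW // -(fE (Ordinal ln)) opprB subrK.
Qed.

Lemma telescope_high l : (l <= n)%N ->
  f l = f n + \sum_(i : 'I_n | (l <= i)%N) z i * t i.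
Proof.
move=> ln; rewrite (telescope_low (leqnn n)) (telescope_low ln).
have -> : \sum_(i : 'I_n | (i < n)%N) z i * t i =
    \sum_(i : 'I_n | (i < l)%N) z i * t i + \sum_(i : 'I_n | (l <= i)%N) z i * t i.
  rewrite (bigID (fun i : 'I_n => (i < l)%N)) /=.
  by congr (_ + _); apply: eq_bigl => i; rewrite ltn_ord // -leqNgt.
by rewrite opprD addrA subrK.
Qed.

End Telescope.

(* a l and f l stand for the values at (y_0, ..., y_(l-1), x_l, ..., x_(n-1)) of a
   matrix A and a vector F with x^k = A F, and D, B for their divided differences; q l
   stands for (x_l^k - y_l^k) / (x_l - y_l). *)
Section Bezoutian.
Variables (V : comNzRingType) (n : nat) (I : V -> Prop).
Hypothesis idI : is_ideal I.
Variables (z q : 'I_n -> V) (a : nat -> 'I_n -> 'I_n -> V) (f : nat -> 'I_n -> V).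
Variables (B : 'I_n -> 'I_n -> V) (D : 'I_n -> 'I_n -> 'I_n -> V).
Hypothesis z_reg : forall l x y, z l * x = z l * y -> x = y.
Hypothesis aD : forall (l : 'I_n) i j, a l i j - a l.+1 i j = z l * D i j l.
Hypothesis fB : forall (l : 'I_n) j, f l j - f l.+1 j = z l * B j l.
Hypothesis afE : forall (l i : 'I_n), \sum_j a l i j * f l j - \sum_j a l.+1 i j * f l.+1 j =
  (i == l)%:R * (z l * q l).
Hypothesis If : forall j, I (f n j).
Hypothesis Iaf : forall i, I (\sum_j a 0%N i j * f 0%N j).

(** The Leibniz rule for divided differences, after cancellation of the regular element z_l. *)
Lemma quotient_expansion (l i : 'I_n) : (i == l)%:R * q l =
  \sum_j (B j l * a l i j + f l.+1 j * D i j l).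
Proof.
apply: (@z_reg l); rewrite mulrCA -afE -sumrB mulr_sumr; apply: eq_bigr => j _.
rewrite ![a _ i j * _]mulrC; exact: divided_difference_mul.
Qed.

(** In [quotient_expansion], telescope a_l back to a_0 and f_(l+1) forward to f_n. Modulo f_n,
    diag(q) becomes M plus antisymmetric Koszul terms, which do not change the determinant modulo I
    since z M is built from a_0 (f_0 - f_n). *)
Lemma bezoutian_congr :
  I (\prod_l q l - \det (\matrix_(i, j) a 0%N i j) * \det (\matrix_(j, l) B j l)).
Proof.
pose zr := \row_l z l : 'rV[V]_n.
pose M := \matrix_(l, i) \sum_j a 0%N i j * B j l : 'M[V]_n.
pose w (p : 'I_n * 'I_n) := \row_i \sum_j D i j p.1 * B j p.2 : 'rV[V]_n.
pose N := \matrix_(k, l) (M k l +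
  \sum_(p <- ord_pairs n) ((k == p.1)%:R * zr 0 p.2 - (k == p.2)%:R * zr 0 p.1) * w p 0 l).
pose U := diag_mx (\row_l q l) : 'M[V]_n.
have UN : I (\det U - \det N).
  apply: (det_congr idI) => l i.
  have -> : U l i - N l i = \sum_j f n j * D i j l.
    have -> : N l i = \sum_j a 0%N i j * B j l +
        (\sum_(j' : 'I_n | (l < j')%N) z j' * w (l, j') 0 i -
         \sum_(i' : 'I_n | (i' < l)%N) z i' * w (i', l) 0 i).
      rewrite -(sum_koszul z (fun p => w p 0 i)) !mxE; congr (_ + _).
      by apply: eq_bigr => p _; rewrite !mxE.
    have -> : U l i = (i == l)%:R * q l by rewrite !mxE eq_sym mulr_natl.
    rewrite quotient_expansion; apply/eqP; rewrite subr_eq; apply/eqP.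
    have -> : \sum_(j' : 'I_n | (l < j')%N) z j' * w (l, j') 0 i =
        \sum_j (\sum_(j' : 'I_n | (l < j')%N) z j' * B j j') * D i j l.
      under [RHS]eq_bigr do rewrite mulr_suml.
      rewrite exchange_big; apply: eq_bigr => j' _; rewrite mxE mulr_sumr.
      by apply: eq_bigr => j _; rewrite -mulrA [B _ _ * _]mulrC.
    have -> : \sum_(i' : 'I_n | (i' < l)%N) z i' * w (i', l) 0 i =
        \sum_j B j l * (\sum_(i' : 'I_n | (i' < l)%N) z i' * D i j i').
      under [RHS]eq_bigr do rewrite mulr_sumr.
      rewrite exchange_big; apply: eq_bigr => i' _; rewrite mxE mulr_sumr.
      by apply: eq_bigr => j _; rewrite mulrA mulrC.
    rewrite -sumrB -!big_split; apply: eq_bigr => j _ /=.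
    rewrite (telescope_low (f := fun l => a l i j) (fun l => aD l i j)) ?(ltnW (ltn_ord l)) //.
    rewrite (telescope_high (f := fun l => f l j) (fun l => fB l j)) ?ltn_ord //.
    rewrite mulrBr mulrDl [B _ _ * a _ _ _]mulrC.
    rewrite [LHS]addrCA; congr (_ + _); rewrite -addrA; congr (_ + _); exact: addrC.
  by apply: (ideal_sum idI) => j _; apply: (idealMr idI).
have NM : I (\det N - \det M).
  apply: (det_koszul_sum idI) => [p|i].
    by rewrite mem_filter => /andP[+ _]; apply: contraTneq => ->; rewrite ltnn.
  rewrite mxE (_ : \sum_l _ = \sum_j a 0%N i j * f 0%N j - \sum_j a 0%N i j * f n j).
    by apply: (idealB idI) => //; apply: (ideal_sum idI) => j _; apply: (idealMl idI).
  rewrite -sumrB.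
  transitivity (\sum_l \sum_j a 0%N i j * (z l * B j l)).
    by apply: eq_bigr => l _; rewrite !mxE mulr_sumr; apply: eq_bigr => j _; rewrite mulrCA.
  rewrite exchange_big; apply: eq_bigr => j _; rewrite -mulrBr -mulr_sumr; congr (_ * _).
  rewrite (telescope_high (f := fun l => f l j) (fun l => fB l j) (leq0n n)) addrC addKr.
  by apply: eq_bigl.
have <- : \det M = \det (\matrix_(i, j) a 0%N i j) * \det (\matrix_(j, l) B j l).
  rewrite -det_mulmx -det_tr; congr (\det _).
  by apply/matrixP => i l; rewrite !mxE; apply: eq_bigr => j _; rewrite !mxE.
have <- : \det U = \prod_l q l by rewrite det_diag; apply: eq_bigr => l _; rewrite mxE.
by rewrite -(subrK (\det N) (\det U)) -addrA; apply: (idealD idI).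
Qed.

End Bezoutian.

Section BezoutianTrace.
Variables (V S : comNzRingType) (n : nat) (I : V -> Prop) (h : nat -> {rmorphism S -> V}).
Hypothesis idI : is_ideal I.
Variables (z q : 'I_n -> V) (A : 'I_n -> 'I_n -> S) (F g : 'I_n -> S).
Hypothesis z_reg : forall l x y, z l * x = z l * y -> x = y.
Hypothesis gE : forall i, g i = \sum_j A i j * F j.
Hypothesis h_diff : forall s (l : 'I_n), exists t, h l s - h l.+1 s = z l * t.
Hypothesis hg : forall (l i : 'I_n), h l (g i) - h l.+1 (g i) = (i == l)%:R * (z l * q l).
Hypothesis hnF : forall j, I (h n (F j)).
Hypothesis h0g : forall i, I (h 0%N (g i)).
Hypothesis Izq : forall l, I (z l * q l).

(* prod q is congruent to (det A)(x) times the Bezoutian of F, and replacing x by y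
   in s does not change s(x) prod q modulo I. *)
Lemma bezoutian_trace s :
  I (h 0%N (s * \det (\matrix_(i, j) A i j))) -> I (h n s * \prod_l q l).
Proof.
move=> IsA.
have /choice[B BP] := fun p : 'I_n * 'I_n => h_diff (F p.1) p.2.
have /choice[D DP] := fun p : 'I_n * 'I_n * 'I_n => h_diff (A p.1.1 p.1.2) p.2.
have hgE r i : \sum_j h r (A i j) * h r (F j) = h r (g i).
  by rewrite gE rmorph_sum; apply: eq_bigr => j _; rewrite rmorphM.
have IUM : I (\prod_l q l - \det (\matrix_(i, j) h 0%N (A i j)) *
    \det (\matrix_(j, l) B (j, l))).
  apply: (bezoutian_congr (a := fun l i j => h l (A i j))
    (f := fun l j => h l (F j)) (D := fun i j l => D (i, j, l)) idI z_reg).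
  - by move=> l i j; apply: (DP (i, j, l)).
  - by move=> l j; apply: (BP (j, l)).
  - by move=> l i; rewrite !hgE.
  - exact: hnF.
  by move=> i; rewrite hgE.
have EM : \matrix_(i, j) h 0%N (A i j) = map_mx (h 0%N) (\matrix_(i, j) A i j).
  by apply/matrixP => i j; rewrite !mxE.
rewrite EM det_map_mx in IUM; set dA := \det _ in IsA IUM; set dB := \det _ in IUM.
have Is0 : I (h 0%N s * \prod_l q l).
  rewrite -(subrK (h 0%N dA * dB) (\prod_l q l)) mulrDr.
  apply: (idealD idI); first exact: (idealMl idI).
  by rewrite mulrA -rmorphM; apply: (idealMr idI).
have /choice[t tE] := h_diff s.
have -> : h n s * \prod_l q l = h 0%N s * \prod_l q l -
    (\sum_(i : 'I_n | (i < n)%N) z i * t i) * \prod_l q l.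
  by rewrite -mulrBl -(telescope_low (f := fun l => h l s) tE).
apply: (idealB idI) => //; rewrite mulr_suml; apply: (ideal_sum idI) => i _.
by rewrite (bigD1 i) //= mulrACA; apply: (idealMr idI).
Qed.

End BezoutianTrace.

Section SocleDegree.
Variables (n : nat) (K : fieldType).
Local Notation S := {mpoly K[n]}.
Local Notation W := {mpoly S[n]}.

(** W is K[y][x], with y inside the coefficients and x outside, so that a coefficient in x is a
    polynomial in y and can be tested for membership in J. *)
Let Xw (i : 'I_n) : W := 'X_i.
Let Yw (i : 'I_n) : W := ('X_i : S)%:MP.
Let z (i : 'I_n) : W := Xw i - Yw i.

(* Writing s as s(x), this is s(y_0, ..., y_(l-1), x_l, ..., x_(n-1)). *)
Definition half_subst (l : nat) : S -> W :=
  mmap (@mpolyC n S \o @mpolyC n K) (fun i : 'I_n => if (i < l)%N then Yw i else Xw i).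

HB.instance Definition _ l := GRing.RMorphism.on (half_subst l).

Lemma half_substX l i : half_subst l 'X_i = if (i < l)%N then Yw i else Xw i.
Proof. by rewrite /half_subst mmapX mmap1U. Qed.

Lemma half_substZ l c s : half_subst l (c *: s) = c%:MP%:MP * half_subst l s.
Proof. exact: mmapZ. Qed.

Lemma half_substE l s : half_subst l s =
  \sum_(a <- msupp s) (s@_a)%:MP%:MP * half_subst l 'X_[a].
Proof.
rewrite {1}[s]mpolyE rmorph_sum; apply: eq_bigr => a _; exact: half_substZ.
Qed.

Lemma half_subst0E s a : (half_subst 0 s)@_a = (s@_a)%:MP.
Proof. exact: (mcoeff_map_mpoly (@mpolyC n K) a s). Qed.

Lemma half_subst_full s : half_subst n s = s%:MP.
Proof.
rewrite half_substE [in RHS](mpolyE s) (raddf_sum (@mpolyC n S)); apply: eq_bigr => a _.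
rewrite /= -mul_mpolyC mpolyCM; congr (_ * _).
elim/mnm_ind: a => [|i a IH]; first by rewrite mpolyX0 rmorph1 mpolyC1.
by rewrite mpolyXD rmorphM mpolyCM /= IH half_substX ltn_ord.
Qed.

Lemma divided_difference s (l : 'I_n) :
  exists t, half_subst l s - half_subst l.+1 s = z l * t.
Proof.
have X a : exists t, half_subst l 'X_[a] - half_subst l.+1 'X_[a] = z l * t.
  elim/mnm_ind: a => [|i a [t tE]]; first by exists 0; rewrite mpolyX0 !rmorph1 subrr mulr0.
  have [u uE] : exists u, half_subst l 'X_i - half_subst l.+1 'X_i = z l * u.
    rewrite !half_substX ltnS; case: ltngtP => [il|il|/val_inj ->].
    - by exists 0; rewrite subrr mulr0.
    - by exists 0; rewrite subrr mulr0.
    by exists 1; rewrite mulr1.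
  exists (u * half_subst l 'X_[a] + half_subst l.+1 'X_i * t).
  have E j : half_subst j 'X_[U_(i) + a] = half_subst j 'X_i * half_subst j 'X_[a].
    by rewrite mpolyXD rmorphM.
  by rewrite !E; apply: divided_difference_mul.
have /choice[t tE] := X.
exists (\sum_(a <- msupp s) (s@_a)%:MP%:MP * t a).
rewrite half_substE [half_subst l.+1 s]half_substE -sumrB mulr_sumr.
by apply: eq_bigr => a _; rewrite -mulrBr tE mulrCA.
Qed.

(** As a polynomial in x, x_l - y_l has leading coefficient 1. *)
Lemma z_reg l (x y : W) : z l * x = z l * y -> x = y.
Proof.
suff : GRing.lreg (z l) by apply.
have Hlt : (mlead (- Yw l) < mlead (Xw l))%O.
  by rewrite mleadN mleadC mleadXm lt_mdeg_ltmc // mdeg0 mdeg1.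
apply: lreg_mleadc; rewrite (mleadDl Hlt) mleadXm mcoeffB mcoeffX eqxx mcoeffC mnm1_eq0.
rewrite mulr0 subr0; exact: lreg1.
Qed.

Lemma det_homog (A : 'M[S]_n) d :
  (forall i j, A i j \is d.-homog) -> \det A \is (n * d).-homog.
Proof.
move=> Ad; apply: rpred_sum => s _.
have H (f : 'I_n -> 'I_n) (r : seq 'I_n) : \prod_(i <- r) A i (f i) \is (size r * d).-homog.
  elim: r => [|i r IH]; first by rewrite big_nil dhomog1.
  by rewrite big_cons mulSn; apply: dhomogM.
rewrite rpredMsign; have := H _ (index_enum 'I_n).
have -> : size (index_enum 'I_n) = n by rewrite -[RHS]card_ord cardT enumT.
exact.
Qed.

Variables (e k : nat) (F : 'I_n -> S).
Hypotheses (F_homog : forall i, F i \is e.-homog) (le_ek : (e <= k.+1)%N).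
Let J := gen_ideal F.
Hypothesis Jpow : forall j, J ('X_j ^+ k.+1).

(** Membership is read off coefficients: a monomial outside the box a_i <= k is a multiple of some
    x_i^(k+1) and imposes no condition. *)
Let I (w : W) : Prop := forall a : 'X_{1..n}, (forall i, a i <= k)%N -> J w@_a.

Lemma box_ideal : is_ideal I.
Proof.
have idJ := gen_idealP F; split=> [a _|x y Ix Iy a ak|c x Ix a ak].
- by rewrite mcoeff0; apply: (ideal0 idJ).
- by rewrite mcoeffD; apply: (idealD idJ); [apply: Ix | apply: Iy].
rewrite (mcoeff_poly_mul_lin _ _ (k := (mdeg a).+1)) //.
apply: (ideal_sum idJ) => b ba; apply: (idealMl idJ); apply: Ix => i.
by rewrite mnmBE (leq_trans (leq_subr _ _)).
Qed.

Lemma box_ideal_const s : J s -> I s%:MP.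
Proof. by move=> Js a _; rewrite mcoeffC; apply: (idealMr (gen_idealP F)). Qed.

Lemma box_ideal_Xw i : I (Xw i ^+ k.+1).
Proof.
move=> a ak; rewrite mpolyXn mcoeffX; case: eqP => [E|_]; last exact: ideal0 (gen_idealP F).
by have := ak i; rewrite -E mulmnE mnm1E eqxx mul1n ltnn.
Qed.

Let q (l : 'I_n) : W := \sum_(r < k.+1) Xw l ^+ (k - r) * Yw l ^+ r.

Lemma zqE l : z l * q l = Xw l ^+ k.+1 - Yw l ^+ k.+1.
Proof.
rewrite subrXX; congr (_ * _); apply: eq_bigr => r _; by rewrite subSS.
Qed.

Lemma half_substXn r i :
  half_subst r ('X_i ^+ k.+1) = (if (i < r)%N then Yw i else Xw i) ^+ k.+1.
Proof. by rewrite rmorphXn; congr (_ ^+ _); exact: half_substX. Qed.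

Lemma half_subst_pow_diff (l i : 'I_n) :
  half_subst l ('X_i ^+ k.+1) - half_subst l.+1 ('X_i ^+ k.+1) = (i == l)%:R * (z l * q l).
Proof.
apply: etrans (congr2 (fun u v => u - v) (half_substXn l i) (half_substXn l.+1 i)) _.
rewrite ltnS -val_eqE /=; case: ltngtP => [il|il|/val_inj ->].
- exact: etrans (subrr _) (esym (mul0r _)).
- exact: etrans (subrr _) (esym (mul0r _)).
exact: etrans (esym (zqE l)) (esym (mul1r _)).
Qed.

Lemma box_ideal_zq l : I (z l * q l).
Proof.
rewrite zqE; apply: (idealB box_ideal (box_ideal_Xw l)).
rewrite -(rmorphXn (@mpolyC n S)); apply: box_ideal_const; exact: Jpow.
Qed.

(** Only the choice r = 0 in every factor reaches exponent k in each x_i. *)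
Lemma mcoeff_prod_q : (\prod_l q l)@_[multinom k | i < n] = 1.
Proof.
rewrite bigA_distr_bigA /= raddf_sum /=.
pose mf (f : {ffun 'I_n -> 'I_k.+1}) : 'X_{1..n} := [multinom (k - f i)%N | i < n].
have E (f : {ffun 'I_n -> 'I_k.+1}) : \prod_i (Xw i ^+ (k - f i) * Yw i ^+ f i) =
    'X_[mf f] * (\prod_i 'X_i ^+ f i : S)%:MP.
  rewrite big_split; congr (_ * _).
    by rewrite mpolyXE_id; apply: eq_bigr => i _; rewrite mnmE.
  by rewrite (rmorph_prod (@mpolyC n S)); apply: eq_bigr => i _; rewrite rmorphXn.
under eq_bigr do rewrite E.
rewrite (bigD1 [ffun=> ord0]) //= [X in _ + X]big1 ?addr0 => [|f f0].
  rewrite mulrC mcoeffCM mcoeffX big1 => [|i _]; last by rewrite ffunE.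
  rewrite mul1r (_ : _ == _) //; apply/eqP/mnmP => i.
  by rewrite !mnmE ffunE subn0.
rewrite mulrC mcoeffCM mcoeffX; case: eqP => [/mnmP E0|]; last by rewrite mulr0.
case/eqP: f0; apply/ffunP => i; apply: val_inj; rewrite ffunE /=.
have := E0 i; rewrite !mnmE; have := ltn_ord (f i); rewrite ltnS => fk E1.
by apply/eqP; rewrite -(eqn_add2l (k - f i)) subnK // addn0 E1.
Qed.

(* Macaulay's bound on the socle degree.  I is generated by the x_i^(k+1) and by J(y);
   modulo I, s(y) prod q is congruent to (s det A)(x) times the Bezoutian of F, where
   x^(k+1) = A F, and this vanishes for degree reasons.  Since prod q has coefficient 1
   at (x_1 ... x_n)^k, it follows that s lies in J. *)
Lemma socle_degree_bound d s : s \is d.-homog -> (n * e.-1 < d)%N -> J s.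
Proof.
move=> sd lt_d; have idJ := gen_idealP F; have idI := box_ideal.
have AP i : exists b : 'I_n -> S, (forall j, b j \is (k.+1 - e).-homog) /\
    'X_i ^+ k.+1 = \sum_j b j * F j.
  apply: (gen_ideal_homog F_homog _ le_ek (Jpow i)); rewrite mpolyXn dhomogX.
  by apply/eqP; rewrite /= mdegMn mdeg1 mul1n.
have /choice[A {}AP] := AP.
have IsA : I (half_subst 0 (s * \det (\matrix_(i, j) A i j))).
  move=> a ak; rewrite half_subst0E.
  have sA : s * \det (\matrix_(i, j) A i j) \is (d + n * (k.+1 - e)).-homog.
    apply: dhomogM => //; apply: det_homog => i j; rewrite mxE.
    by have [] := AP i.
  rewrite (dhomog_nemf_coeff sA) ?mpolyC0; first exact: (ideal0 idJ).
  (* Degree count: s det A has degree d + n(k+1-e) > n(e-1) + n(k+1-e) >= n k, the largest degree in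
     the box, where e - 1 is read as 0 for e = 0. *)
  have ad : (mdeg a <= n * k)%N.
    rewrite mdegE -[X in (X * k)%N]card_ord -sum_nat_const.
    by apply: leq_sum => i _; apply: ak.
  rewrite neq_ltn (leq_ltn_trans ad) //.
  apply: (@leq_ltn_trans (n * e.-1 + n * (k.+1 - e))%N); last by rewrite ltn_add2r.
  by rewrite -mulnDr leq_mul2l; apply/orP; right; case: (e) => [|e'] /=; lia.
have Isn : I (half_subst n s * \prod_l q l).
  apply: (@bezoutian_trace _ _ n I half_subst idI z q A F (fun i => 'X_i ^+ k.+1)).
  - exact: z_reg.
  - by move=> i; have [] := AP i.
  - exact: divided_difference.
  - exact: half_subst_pow_diff.
  - by move=> j; have := box_ideal_const (gen_ideal_gen F j); rewrite -half_subst_full.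
  - by move=> i; have := box_ideal_Xw i; rewrite -(half_substXn 0 i).
  - exact: box_ideal_zq.
  exact: IsA.
have := Isn [multinom k | i < n]; rewrite half_subst_full mcoeffCM mcoeff_prod_q mulr1.
by apply=> i; rewrite mnmE.
Qed.

End SocleDegree.

(** * Conclusion *)

Section Uncountable.
Variable R : realType.

Lemma avoid_seq (s : seq R) (a b : R) : a < b ->
  exists a' b', [/\ a <= a', a' < b', b' <= b & forall x, a' <= x <= b' -> x \notin s].
Proof.
elim: s a b => [|c s IH] a b ab; first by exists a, b.
have [a' [b' [aa' a'b' b'b cs]]] : exists a' b', [/\ a <= a', a' < b', b' <= b &
    forall x, a' <= x <= b' -> x != c].
  (* The closed subinterval must miss c; since c may be the midpoint, the left end moves a quarter
     of the length beyond it. *)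
  have [ca|ac] := leP c ((a + b) / 2%:R).
    exists ((a + b) / 2%:R + (b - a) / 4%:R), b; split; [lra|lra|lra|].
    by move=> x /andP[xl _]; rewrite gt_eqF //; lra.
  exists a, ((a + b) / 2%:R); split; [lra|lra|lra|].
  by move=> x /andP[_ xr]; rewrite lt_eqF //; lra.
have [a'' [b'' [? ? ? H]]] := IH _ _ a'b'; exists a'', b''; split=> // [||x xab].
- exact: le_trans aa' _.
- exact: le_trans b'b.
rewrite inE negb_or H // andbT; apply: cs.
by case/andP: xab => xl xr; rewrite (le_trans _ xl) // (le_trans xr).
Qed.

(* Cantor's nested intervals. *)
Lemma real_not_countable_union_finite (F : R -> nat) : exists d, forall N,
  exists s : seq R, [/\ uniq s, size s = N & all (fun c => (F c <= d)%N) s].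
Proof.
apply: contrapT => /forallNP H.
have fin d : exists s : seq R, forall x, (F x <= d)%N -> x \in s.
  apply: contrapT => /forallNP Hs; apply: (H d) => N.
  elim: N => [|N [s [us sz sd]]]; first by exists [::].
  have /existsNP[x /not_implyP[xd /negP xs]] := Hs s.
  by exists (x :: s); rewrite /= xs us sz xd.
have step d (ab : R * R) : exists ab' : R * R, ab.1 < ab.2 ->
    [/\ ab.1 <= ab'.1, ab'.1 < ab'.2, ab'.2 <= ab.2 &
        forall x, ab'.1 <= x <= ab'.2 -> (d < F x)%N].
  have [lt_ab|] := boolP (ab.1 < ab.2); last by exists ab.
  have [s sP] := fin d; have [a' [b' [? ? ? cs]]] := avoid_seq s lt_ab.
  exists (a', b') => _; split=> // x /cs; rewrite ltnNge; apply: contra; exact: sP.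
have /choice[G GP] := fun p : nat * (R * R) => step p.1 p.2.
pose fix u d : R * R := if d is d'.+1 then G (d', u d') else (0, 1).
have ult d : (u d).1 < (u d).2.
  by elim: d => [|d IHd] /=; [rewrite ltr01 | have [] := GP (d, u d) IHd].
have umono d e : (d <= e)%N -> (u d).1 <= (u e).1 /\ (u e).2 <= (u d).2.
  move=> /subnK <-; elim: (e - d)%N => [|j [IH1 IH2]]; first by [].
  have [? _ ? _] := GP ((j + d)%N, u (j + d)%N) (ult (j + d)%N).
  by rewrite addSn /=; split; [apply: le_trans IH1 _ | apply: le_trans IH2].
have uub d e : (u d).1 <= (u e).2.
  have [d1 _] := umono _ _ (leq_maxl d e); have [_ e2] := umono _ _ (leq_maxr d e).
  by apply: le_trans d1 (le_trans (ltW (ult _)) e2).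
pose E : classical_sets.set R := fun x => exists d, x = (u d).1.
have Eub d : classical_sets.ubound E (u d).2 by move=> x [e ->].
have E0 : E (u 0%N).1 by exists 0%N.
have Esup : classical_sets.has_sup E by split; [exists (u 0%N).1 | exists (u 0%N).2].
have supE d : (u d).1 <= sup E <= (u d).2.
  apply/andP; split; first by apply: ub_le_sup; [case: Esup | exists d].
  by apply: ge_sup; [case: Esup | apply: Eub].
(* The supremum lies in every interval, but on interval number F(sup E) + 1 all values of F exceed
   F(sup E). *)
have [_ _ _ /(_ (sup E) (supE (F (sup E)).+1))] := GP (F (sup E), u (F (sup E))) (ult _).
by rewrite ltnn.
Qed.

End Uncountable.

(** * Regular forms and their Jacobian ideals *)

Section Regular.
Variables (n : nat) (K : numFieldType).
Local Notation S := {mpoly K[n]}.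

Lemma mderiv_homog m (p : S) i : p \is m.-homog -> p^`M(i) \is m.-1.-homog.
Proof.
move=> pm; apply/dhomogP => a; rewrite mcoeff_msupp mcoeff_deriv => pa.
have : (a + U_(i))%MM \in msupp p.
  by rewrite mcoeff_msupp; apply: contra pa => /eqP ->; rewrite mul0rn.
by move=> /(dhomog_mf pm) /=; rewrite mdegD mdeg1 addn1 => <-.
Qed.

Lemma euler_identity m (p : S) : p \is m.-homog -> \sum_i 'X_i * p^`M(i) = p *+ m.
Proof.
move=> pm; rewrite {2}[p]mpolyE -sumrMnl.
under eq_bigr => i _.
  rewrite {1}[p]mpolyE (raddf_sum (mderiv i)) mulr_sumr; over.
rewrite exchange_big big_seq [RHS]big_seq; apply: eq_bigr => a ap /=.
rewrite -(dhomog_mf pm ap) /= mdegE -sumrMnr; apply: eq_bigr => i _.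
rewrite mderivZ mderivX -!scalerAr scalerMnr scaler_nat; congr (_ *: _).
have [->|ai] := eqVneq (a i) 0%N; first by rewrite !mulr0n.
by rewrite -mpolyXD addmC submK // lep1mP.
Qed.

(** Regularity only speaks of zeros of p; by Euler's identity, with m invertible in K, a common zero
    of the partial derivatives is one. *)
Lemma regular_zeros m (p : S) : (0 < m)%N -> regular m p ->
  forall c : 'I_n -> K, (forall i, (p^`M(i)).@[c] = 0) -> forall i, c i = 0.
Proof.
move=> m0 [pm preg] c c0 i; apply/eqP; apply: contraT => ci.
have pc0 : p.@[c] = 0.
  have := congr1 (meval c) (euler_identity pm); rewrite raddf_sum raddfMn /= big1 => [|j _].
    by move/esym/eqP; rewrite mulrn_eq0 -leqn0 leqNgt m0 => /eqP.
  by rewrite mevalM c0 mulr0.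
have [|j] := preg c _ pc0; first by exists i.
by rewrite c0 eqxx.
Qed.

Lemma fermat_regular m : (0 < m)%N -> regular m (fermat n K m).
Proof.
move=> m0; split.
  apply: rpred_sum => i _; rewrite mpolyXn dhomogX.
  by apply/eqP; rewrite /= mdegMn mdeg1 mul1n.
move=> v [i vi] _; exists i; rewrite deriv_fermat mevalZ -mpolyXn rmorphXn /= mevalXU.
by rewrite mulf_neq0 ?expf_neq0 // pnatr_eq0 -lt0n.
Qed.

End Regular.

Section Main.
Variables (n : nat) (K : numClosedFieldType).
Hypothesis uncountable_K : forall F : K -> nat, exists d, forall N,
  exists s : seq K, [/\ uniq s, size s = N & all (fun c => (F c <= d)%N) s].

Lemma regular_mem_jacobian m (p : {mpoly K[n]}) d s : (0 < m)%N -> regular m p ->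
  s \is d.-homog -> (n * (m - 2) < d)%N -> gen_ideal (fun i => p^`M(i)) s.
Proof.
move=> m0 preg sd lt_d; set F := fun i => p^`M(i).
have Fh i : F i \is m.-1.-homog by apply: mderiv_homog; case: preg.
have /choice[r rP] := power_in_gen_ideal uncountable_K Fh (regular_zeros m0 preg).
(* One exponent k + 1 that serves all variables and is also at least the degree m - 1 of the
   generators. *)
pose k := (\sum_i r i + m.-1)%N.
apply: (@socle_degree_bound n K m.-1 k F Fh _ _ d) => // [|j|].
- by rewrite /k leqW ?leq_addl.
- have rk : (r j <= k.+1)%N by rewrite /k (bigD1 j) //= leqW // -!addnA leq_addr.
  by rewrite -(subnK rk) exprD; apply: (idealMl (gen_idealP F)).
by rewrite -subn2 in lt_d *; case: (m) lt_d => [|[|m']].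
Qed.

Lemma regular_determined m (p : {mpoly K[n]}) (g : cps n K) :
    (0 < m)%N -> (1 < n.-1 * (m - 2))%N -> regular m p ->
    ordge (n * (m - 2)).+1 (g - cps_of_mpoly p)%R ->
  right_equiv (cps_of_mpoly p) g.
Proof.
(* This k solves k + m = N + 1, and [nm] makes it positive. *)
move=> m0 nm preg; pose k := (n.-1 * (m - 2)).-1.
have kE : (n * (m - 2)).+1 = (k + m)%N.
  by rewrite /k; move: nm; case: (n) => // n' /=; rewrite mulSn; case: (m) m0 => [|[|m']] // _; lia.
have pm : p \is m.-homog by case: preg.
have tP (b : 'X_{1..n}) : exists t : 'I_n -> {mpoly K[n]}, mdeg b = (k + m)%N ->
    (forall i, t i \is k.+1.-homog) /\ 'X_[b] = \sum_i t i * p^`M(i).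
  have [bk|bk] := eqVneq (mdeg b) (k + m)%N; last first.
    by exists (fun=> 0) => bk'; rewrite bk' eqxx in bk.
  have Xb : 'X_[b] \is [in K[n], (k + m).-homog] by rewrite dhomogX; apply/eqP.
  have lt_km : (n * (m - 2) < k + m)%N by rewrite -kE.
  have Jb := regular_mem_jacobian m0 preg Xb lt_km.
  have le_e : (m.-1 <= k + m)%N by rewrite (leq_trans (leq_pred _)) ?leq_addl.
  have [t [th tE]] := gen_ideal_homog (fun i => mderiv_homog i pm) Xb le_e Jb.
  exists t => _; split=> // i; have := th i.
  by rewrite (_ : k + m - m.-1 = k.+1)%N //; case: (m) m0 => // m' _ /=; lia.
have /choice[t {}tP] := tP; rewrite kE.
apply: (jacobian_determined _ pm (t := t)).
- by rewrite /k; case: (_ * _)%N nm => [|[|]].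
- by move=> b i /tP[].
by move=> b /tP[].
Qed.

End Main.

Local Open Scope complex_scope.

(** The excluded pairs (n, m) are (2, 3), (3, 3) and (2, 4), with N = 2, 3 and 4; they are those
    with N <= m. *)
Lemma degree_bounds (n m : nat) : (2 <= n)%N -> (3 <= m)%N ->
  (m = 3%N -> (4 <= n)%N) -> (m = 4%N -> (3 <= n)%N) ->
  (m < n * (m - 2))%N /\ (1 < n.-1 * (m - 2))%N.
Proof.
move=> n2 m3 n3 n4; have [E|m3'] := eqVneq m 3%N.
  by have := n3 E; rewrite E; lia.
have [E|m4] := eqVneq m 4%N; first by have := n4 E; rewrite E; lia.
have m5 : (5 <= m)%N by lia.
by split; nia.
Qed.

Lemma complex_uncountable (R : realType) (F : R[i] -> nat) : exists d, forall N,
  exists s : seq R[i], [/\ uniq s, size s = N & all (fun c => (F c <= d)%N) s].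
Proof.
have [d dP] := real_not_countable_union_finite (fun x : R => F x%:C).
exists d => N; have [s [us sz sd]] := dP N.
exists [seq x%:C | x <- s]; rewrite size_map all_map; split=> //.
by rewrite map_inj_uniq // => x y; apply: fmorph_inj.
Qed.

Theorem theorem3p2 (R : realType) (n m : nat)
    (n_ge2 : (2 <= n)%N) (m_ge3 : (3 <= m)%N)
    (n_m3 : m = 3%N -> (4 <= n)%N) (n_m4 : m = 4%N -> (3 <= n)%N) :
  ~ determined (n * (m - 2) - 1)%N (cps_of_mpoly (fermat n R[i] m))
  /\ is_Dnm n R[i] m (n * (m - 2) + 1)%N.
Proof.
have [N_gtm kn] := degree_bounds n_ge2 m_ge3 n_m3 n_m4.
have m_gt0 : (0 < m)%N by apply: leq_trans m_ge3.
have not_contact := @fermat_top_not_contact n R[i] m m_ge3 N_gtm.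
set f := fermat n R[i] m in not_contact *.
set g := f + _ in not_contact.
have gf : ideal_pow (@maxideal n R[i]) (n * (m - 2)) (cps_of_mpoly g - cps_of_mpoly f).
  have -> : cps_of_mpoly g - cps_of_mpoly f = cps_of_mpoly 'X_[fermat_top n m].
    by rewrite -rmorphB /g addrC addKr.
  by apply: ideal_pow_Xm; apply: mdeg_fermat_top.
split=> [det_f|].
  (* [determined k] tests differences in m^(k+1), so k = N - 1 admits g, whose difference w from f
     lies in m^N. *)
  apply: not_contact; have [|phi phi_bij phiE] := det_f (cps_of_mpoly g).
    by rewrite subn1 prednK // (leq_ltn_trans _ N_gtm).
  by exists phi => //; exists 1; rewrite ?unitr1 ?mul1r.
split=> [|p preg d le_d h hp|D lt_mD DP]; first by rewrite addn1 ltnW.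
  have [|phi phi_bij phiE] := regular_determined (@complex_uncountable R) m_gt0 kn preg (g := h).
    by apply: ordgeW (ideal_pow_ordge hp); rewrite -addn1.
  by exists phi => //; exists 1; rewrite ?unitr1 ?mul1r.
(* A smaller D would be at most N, so its property could be applied to f and g with d = N. *)
rewrite addn1 ltnNge; apply/negP => leD; apply: not_contact.
exact: (DP f (fermat_regular _ _ m_gt0) _ leD _ gf).
Qed.
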